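(* Let $\mathfrak g$ be a weakly root graded complex Banach--Lie algebra, let $\mathfrak p\subseteq\mathfrak g$ be a parabolic subalgebra, let $(\rho,E)$ be a $\mathfrak p$-module which decomposes as a finite direct sum of $\mathfrak h$-weight spaces, and let $V:=\mathrm{Hom}_{\mathfrak p}(U(\mathfrak g),E)^{[\mathfrak h]}$ be the $\mathfrak h$-finite part of the corresponding coinduced representation. Then: (a) $V$ is a direct sum of $\mathfrak h$-weight spaces, and the set $\mathcal P(V,\mathfrak h)$ of $\mathfrak h$-weights of $V$ is contained in $\mathcal P(E,\mathfrak h)-\mathrm{span}_{\mathbb N_0}\Sigma^-$. (b) The subspace $V^{[\mathfrak g_\Delta]}$ of $\mathfrak g_\Delta$-finite vectors is a $\mathfrak g$-module (under the action of $\mathfrak g$ on the coinduced representation) which decomposes into finitely many $\mathfrak h$-weight spaces. (c) $V$ is a locally finite module of $\mathfrak n_\Delta\rtimes\mathfrak l_\Delta$. (d) There exists $k\in\mathbb N$ with $V^{[\mathfrak g_\Delta]}=\{v\in V:\ \mathfrak u_\Delta^k.v=\{0\}\}$. (e) There exists $k\in\mathbb N$ with $V^{[\mathfrak g_\Delta]}\subseteq\{v\in V:\ \mathfrak n^k.v=\{0\}\}$.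
   Context: Weakly root graded Lie algebras: Let $\Delta$ be a finite reduced root system and $\mathfrak g_\Delta$ the corresponding finite-dimensional complex semisimple Lie algebra. A complex Banach--Lie algebra $\mathfrak g$ is weakly $\Delta$-graded if $\mathfrak g_\Delta$ is a Lie subalgebra of $\mathfrak g$ and, for some (hence each) Cartan subalgebra $\mathfrak h$ of $\mathfrak g_\Delta$, $\mathfrak g=\mathfrak g_0\oplus\bigoplus_{\alpha\in\mathcal R}\mathfrak g_\alpha$ (a finite direct sum), where $\mathfrak g_\alpha=\{x\in\mathfrak g:[h,x]=\alpha(h)x\ \forall h\in\mathfrak h\}$ and $\mathcal R\subseteq\mathfrak h^*\setminus\{0\}$ is the finite set of nonzero weights occurring. It is weakly root graded if it is weakly $\Delta$-graded for some $\Delta$. Fix $\mathfrak h$. For $\alpha\in\Delta$ the coroot $\check\alpha$ is the unique element of $[\mathfrak g_{\Delta,\alpha},\mathfrak g_{\Delta,-\alpha}]$ with $\alpha(\check\alpha)=2$; $\mathfrak h_{\mathbb R}$ is the real span of the coroots, and all elements of $\mathcal R$ are real-valued on it. Parabolic subalgebras: A parabolic system is a set $\Sigma=\{\alpha\in\mathcal R:\alpha(x_\Sigma)\ge 0\}$ for some (fixed) $x_\Sigma\in\mathfrak h_{\mathbb R}$. Put $\Sigma^+=\{\alpha\in\mathcal R:\alpha(x_\Sigma)>0\}$, $\Sigma^0=\{\alpha\in\mathcal R:\alpha(x_\Sigma)=0\}$, $\Sigma^-=\mathcal R\setminus\Sigma$. The corresponding parabolic subalgebra is $\mathfrak p=\mathfrak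 u\rtimes\mathfrak l$ with $\mathfrak u=\sum_{\alpha\in\Sigma^+}\mathfrak g_\alpha$, $\mathfrak l=\mathfrak g_0+\sum_{\alpha\in\Sigma^0}\mathfrak g_\alpha$; further $\mathfrak n=\sum_{\alpha\in\Sigma^-}\mathfrak g_\alpha$, so $\mathfrak g=\mathfrak n\oplus\mathfrak l\oplus\mathfrak u$. Put $\mathfrak u_\Delta=\mathfrak u\cap\mathfrak g_\Delta$, $\mathfrak l_\Delta=\mathfrak l\cap\mathfrak g_\Delta$, $\mathfrak n_\Delta=\mathfrak n\cap\mathfrak g_\Delta$. Modules: $U(\mathfrak g)$ is the (algebraic) universal enveloping algebra. $\mathrm{Hom}_{\mathfrak p}(U(\mathfrak g),E)$ is the space of all linear maps $\beta:U(\mathfrak g)\to E$ with $\beta(Dx)=-\rho(x)\beta(D)$ for $x\in\mathfrak p$, $D\in U(\mathfrak g)$; it is a $\mathfrak g$-module (the coinduced representation) via $(x.\beta)(D)=-\beta(xD)$. For a module $W$ of a Lie algebra and a subalgebra $\mathfrak k$, $W^{[\mathfrak k]}=\{v\in W:\dim(U(\mathfrak k)v)<\infty\}$ is the space of $\mathfrak k$-finite vectors; $W$ is a locally finite $\mathfrak k$-module if $W^{[\mathfrak k]}=W$. $\mathfrak h$-weight spaces are simultaneous $\mathfrak h$-eigenspaces $W_\alpha=\{w: h.w=\alpha(h)w\ \forall h\in\mathfrak h\}$, $\alpha\in\mathfrak h^*$, and $\mathcal P(W,\mathfrak h)$ denotes the set of $\alpha$ with $W_\alpha\ne\{0\}$.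 $\mathfrak a^k.v=\{0\}$ means $a_1.(a_2.(\cdots a_k.v))=0$ for all $a_1,\dots,a_k\in\mathfrak a$. *)

(* Defs.v *)
(* The complex numbers are R[i] for R : realType. *)
From HB Require Import structures.
From mathcomp Require Import all_boot all_algebra complex.
From mathcomp Require Import boolp classical_sets functions cardinality reals.
From mathcomp Require Import topology normedtype.

Set Implicit Arguments.
Unset Strict Implicit.
Unset Printing Implicit Defensive.

Import GRing.Theory Num.Theory.
Import numFieldNormedType.Exports.
Local Open Scope classical_set_scope.
Local Open Scope ring_scope.
Local Open Scope complex_scope.

HB.mixin Record Lmodule_isLieAlgebra (K : nzRingType) L of GRing.Lmodule K L := {
  lie : L -> L -> L ;
  lie_linearl : forall y, linear (fun x => lie x y) ;
  lie_linearr : forall x, linear (lie x) ;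
  lie_alternating : forall x, lie x x = 0 ;
  lie_jacobi : forall x y z,
    lie x (lie y z) + lie y (lie z x) + lie z (lie x y) = 0
}.

#[short(type="lieAlgType")]
HB.structure Definition LieAlgebra (K : nzRingType) :=
  {L of GRing.Lmodule K L & Lmodule_isLieAlgebra K L}.

HB.mixin Record hasContinuousLie (K : numFieldType) L
    of CompleteNormedModule K L & Lmodule_isLieAlgebra K L := {
  lie_continuous : continuous (fun z : L * L => (lie z.1 z.2 : L))
}.

#[short(type="banachLieType")]
HB.structure Definition BanachLieAlgebra (K : numFieldType) :=
  {L of CompleteNormedModule K L & Lmodule_isLieAlgebra K L
      & hasContinuousLie K L}.

Section LinearAlgebra.
Variables (K : fieldType) (M : lmodType K).
Implicit Types (A B W : set M).

Definition subspace W : Prop :=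
  W 0 /\ forall (a : K) (x y : M), W x -> W y -> W (a *: x + y).

Definition lspan A : set M := [set w | exists (n : nat) (c : 'I_n -> K)
  (x : 'I_n -> M), (forall j, A (x j)) /\ w = \sum_(j < n) c j *: x j].

Definition fin_dim W : Prop := exists (n : nat) (e : 'I_n -> M),
  forall w, W w -> exists c : 'I_n -> K, w = \sum_(j < n) c j *: e j.

Definition sum_set A B : set M := [set w | exists x y, A x /\ B y /\ w = x + y].

(* W is the internal direct sum of the subspaces F i, i : I. *)
Definition direct_sum (I : eqType) (F : I -> set M) W : Prop :=
  [/\ forall i, subspace (F i) /\ F i `<=` W,
      forall w, W w -> exists (s : seq I) (x : I -> M),
        (forall i, i \in s -> F i (x i)) /\ w = \sum_(i <- s) x i &
      forall (s : seq I) (x : I -> M), uniq s ->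
        (forall i, i \in s -> F i (x i)) -> \sum_(i <- s) x i = 0 ->
        forall i, i \in s -> x i = 0].

End LinearAlgebra.

Section LieSubalgebras.
Variables (K : fieldType) (g : lieAlgType K).
Implicit Types (A B I k h : set g).

Definition lie_span A B : set g :=
  lspan [set z | exists x y, A x /\ B y /\ z = lie x y].

Definition lie_subalgebra k : Prop :=
  subspace k /\ forall x y, k x -> k y -> k (lie x y).

Definition lie_ideal I k : Prop :=
  [/\ subspace I, I `<=` k & forall x y, k x -> I y -> I (lie x y)].

Definition lie_solvable k : Prop :=
  exists n, iter n (fun A => lie_span A A) k `<=` [set 0].

Definition lie_nilpotent k : Prop :=
  exists n, iter n (lie_span k) k `<=` [set 0].

Definition lie_semisimple k : Prop :=
  forall I, lie_ideal I k -> lie_solvable I -> I `<=` [set 0].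

Definition cartan_subalgebra h k : Prop :=
  [/\ lie_subalgebra h, h `<=` k, lie_nilpotent h &
      forall x, k x -> (forall y, h y -> h (lie x y)) -> h x].

End LieSubalgebras.

Section Modules.
Variables (K : fieldType) (g : lieAlgType K) (M : lmodType K).
Variable act : g -> M -> M.
Implicit Types (k : set g) (W : set M) (v : M).

(* W is a module of the subalgebra k of g; the values of act outside k and W
   play no role. *)
Definition lie_module k W : Prop :=
  [/\ subspace W,
      forall x v, k x -> W v -> W (act x v),
      forall x (a : K) v w, k x -> W v -> W w ->
        act x (a *: v + w) = a *: act x v + act x w,
      forall (a : K) x y v, k x -> k y -> W v ->
        act (a *: x + y) v = a *: act x v + act y v &
      forall x y v, k x -> k y -> W v ->
        act (lie x y) v = act x (act y v) - act y (act x v)].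

(* U(k) v : the enveloping algebra is spanned by the products of elements
   of k. *)
Definition env_orbit k v : set M :=
  lspan [set w | exists s : seq g,
    (forall x, x \in s -> k x) /\ w = foldr act v s].

Definition finite_vectors k W : set M :=
  [set v | W v /\ fin_dim (env_orbit k v)].

Definition locally_finite_module k W : Prop :=
  lie_module k W /\ finite_vectors k W = W.

Definition pow_kills k (n : nat) v : Prop :=
  forall s : seq g, size s = n -> (forall x, x \in s -> k x) ->
  foldr act v s = 0.

End Modules.

(* The Cartan subalgebra is the image of an injective linear map i : h -> g from
   a finite-dimensional space h, so that its dual is 'Hom(h, K^o). *)
Section Weights.
Variables (K : fieldType) (g : lieAlgType K) (h : vectType K).
Variables (i : {linear h -> g}) (M : lmodType K) (act : g -> M -> M).
Implicit Types (W : set M) (alpha : 'Hom(h, K^o)).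

Definition weight_space W alpha : set M :=
  [set v | W v /\ forall t : h, act (i t) v = alpha t *: v].

Definition weights W : set 'Hom(h, K^o) :=
  [set alpha | exists v, weight_space W alpha v /\ v != 0].

Definition sum_of_weight_spaces W : Prop := direct_sum (weight_space W) W.

Definition finite_sum_of_weight_spaces W : Prop :=
  sum_of_weight_spaces W /\ finite_set (weights W).

End Weights.

Definition nat_span (V : zmodType) (S : set V) : set V :=
  [set v | exists s : seq V, (forall x, x \in s -> S x) /\ v = \sum_(x <- s) x].

Definition diff_set (V : zmodType) (A B : set V) : set V :=
  [set v | exists x y, A x /\ B y /\ v = x - y].

Section RootSystems.
Variables (R : realType) (V : vectType R) (Delta : seq V).

Definition coroot_form (alpha : V) (f : 'Hom(V, R^o)) : Prop :=
  f alpha = 2 /\ forall beta, beta \in Delta -> beta - f beta *: alpha \in Delta.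

Definition reduced_root_system : Prop :=
  [/\ (<<Delta>> = fullv)%VS, 0 \notin Delta,
      forall alpha, alpha \in Delta -> exists f, coroot_form alpha f /\
        forall beta, beta \in Delta -> f beta \is a Num.int &
      forall alpha (c : R), alpha \in Delta -> c *: alpha \in Delta ->
        c = 1 \/ c = -1].

End RootSystems.

Section RootGraded.
Variables (R : realType) (g : banachLieType R[i]) (gD : set g).
Variables (h : vectType R[i]) (i : {linear h -> g}).
Local Notation dual := 'Hom(h, R[i]^o).

Definition root_space (alpha : dual) : set g :=
  weight_space i (@lie _ g) gD alpha.

Definition roots : set dual := weights i (@lie _ g) gD `\ 0.

Definition is_coroot (alpha : dual) (t : h) : Prop :=
  lie_span (root_space alpha) (root_space (- alpha)) (i t) /\ alpha t = 2.

(* gD is the finite-dimensional semisimple Lie algebra g_Delta with Cartan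
   subalgebra i(h): phi identifies the abstract root system Delta, with its
   coroots, with the root system of (gD, h), with its coroots.  The clause on
   coroots is the standard fact that [gD_alpha, gD_(- alpha)] contains the
   coroot of alpha; it is part of the identification. *)
Definition semisimple_of_type (V : vectType R) (Delta : seq V) : Prop :=
  [/\ lie_subalgebra gD, fin_dim gD, lie_semisimple gD,
      injective i /\ cartan_subalgebra (range i) gD &
      exists phi : V -> dual,
        [/\ forall (a : R) u v, phi (a *: u + v) = a%:C *: phi u + phi v,
            injective phi,
            roots = [set phi alpha | alpha in [set` Delta]] &
            forall alpha f, alpha \in Delta -> coroot_form Delta alpha f ->
              exists t, is_coroot (phi alpha) t /\
                forall v, phi v t = (f v)%:C]].

Definition weakly_graded (V : vectType R) (Delta : seq V) : Prop :=
  [/\ reduced_root_system Delta, semisimple_of_type Delta &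
      finite_sum_of_weight_spaces i (@lie _ g) setT].

Definition graded_part (alpha : dual) : set g :=
  weight_space i (@lie _ g) setT alpha.

(* The set of nonzero weights occurring in g (not only in gD). *)
Definition graded_weights : set dual := weights i (@lie _ g) setT `\ 0.

Definition sum_of_parts (S : set dual) : set g :=
  lspan (\bigcup_(alpha in S) graded_part alpha).

Definition h_real : set h := [set t | exists (n : nat) (a : 'I_n -> R)
  (c : 'I_n -> h), (forall j, exists2 alpha, roots alpha & is_coroot alpha (c j))
  /\ t = \sum_(j < n) (a j)%:C *: c j].

Variable xS : h.

(* In R[i], 0 <= z means that z is real and nonnegative. *)
Definition Sigma : set dual :=
  [set alpha | graded_weights alpha /\ 0 <= alpha xS].
Definition Sigma_pos : set dual :=
  [set alpha | graded_weights alpha /\ 0 < alpha xS].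
Definition Sigma_zero : set dual :=
  [set alpha | graded_weights alpha /\ alpha xS = 0].
Definition Sigma_neg : set dual := graded_weights `\` Sigma.

Definition par_u : set g := sum_of_parts Sigma_pos.
Definition par_l : set g :=
  sum_set (graded_part 0) (sum_of_parts Sigma_zero).
Definition par_n : set g := sum_of_parts Sigma_neg.
Definition parabolic : set g := sum_set par_u par_l.

End RootGraded.

(* U is characterized by its universal property, iota being the canonical map;
   algType requires 1 != 0, which excludes no enveloping algebra. *)
Definition universal_enveloping (K : fieldType) (g : lieAlgType K)
    (U : algType K) (iota : {linear g -> U}) : Prop :=
  (forall x y, iota (lie x y) = iota x * iota y - iota y * iota x) /\
  forall (A : algType K) (f : {linear g -> A}),
    (forall x y, f (lie x y) = f x * f y - f y * f x) ->
    exists F : {lrmorphism U -> A}, (forall x, F (iota x) = f x) /\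
      forall F' : {lrmorphism U -> A}, (forall x, F' (iota x) = f x) -> F' =1 F.

Section Coinduced.
Variables (K : fieldType) (g : lieAlgType K) (U : algType K).
Variables (iota : {linear g -> U}) (E : lmodType K).

Definition coinduced (p : set g) (rho : g -> E -> E) : set (U -> E) :=
  [set beta | linear beta /\
    forall x D, p x -> beta (D * iota x) = - rho x (beta D)].

Definition coind_act (x : g) (beta : U -> E) : U -> E :=
  fun D => - beta (iota x * D).

End Coinduced.

(* Main.v *)
Require Import Defs.
From HB Require Import structures.
From mathcomp Require Import all_boot all_algebra complex.
From mathcomp Require Import boolp classical_sets functions cardinality reals.
From mathcomp Require Import topology normedtype.
From mathcomp Require Import order zify ring.

(** Write V for the h-finite part of the coinduced module, and let the height of
    a weight be the real part of its value at x_Sigma. Everything rests on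
    weights and their heights.

    Since U(g) is spanned by products of ad-h weight vectors and E by weight
    vectors, every h-finite element of the coinduced module is a sum of weight
    vectors ([finite_vectors_diag], [finite_vectors_gen]). Reordering products
    gives U(g) = U(n) U(p), so an element of Hom_p(U(g), E) is determined on
    products of elements of n; a weight of V is thus a weight of E minus a sum
    of elements of Sigma^- ([weight_of_finite_vectors]), which is (a). The
    weights of g are real at x_Sigma, because coroots take integral values on
    them by sl2-theory ([coroot_integral]). Elements of Sigma^- therefore have
    heights bounded away from 0, so the heights of the weights of V are bounded
    below and only finitely many weights lie below any given height
    ([weight_height], [bounded_weights_finite]). In particular a weight vector
    of g of nonzero weight and height <= 0 acts locally nilpotently on V.

    The second ingredient is [locally_finite_orbit]: if a Lie algebra is spanned
    by finitely many elements which act locally finitely on a module, then its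
    orbits are finite-dimensional, since all products are combinations of sorted
    ones. It gives (c) at once. It also shows that the g_Delta-finite vectors of
    V are those on which all root vectors of g_Delta act nilpotently
    ([finite_vectors_integrable]); as the root vectors are ad-nilpotent on all
    of g, this description is visibly g-stable.

    The third ingredient bounds the heights of the weights of the g_Delta-finite
    part from above ([integrable_height_bound]). These weights are permuted by
    the reflections, so the lower bound also holds at each point of a finite set
    which contains x_Sigma and is stable under reflections; the sum of that set
    is 0, which turns the lower bound into an upper bound. Hence the
    g_Delta-finite part has finitely many weights, which completes (b), and long
    products of elements of u, which raise heights, or of n, which lower them,
    vanish on it ([bounded_word_kills]); this is (e) and one half of (d).
    Conversely, if u_Delta^k kills v, then the root
    vectors of positive height are nilpotent on v, and the others always are. *)

Set Implicit Arguments.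
Unset Strict Implicit.
Unset Printing Implicit Defensive.

Import Order.TTheory GRing.Theory Num.Theory.
Import numFieldNormedType.Exports.
Local Open Scope classical_set_scope.
Local Open Scope ring_scope.
Local Open Scope complex_scope.

(* Linear subspaces, not subspace topologies. *)
Local Notation subspace := Defs.subspace.

(** * Spans and finite-dimensional subspaces *)

Section Spans.
Variables (K : fieldType) (M : lmodType K).
Implicit Types (A B W : set M).

Section Subspace.
Variables (W : set M) (subW : subspace W).

Lemma subspace0 : W 0. Proof. by case: subW. Qed.

Lemma subspaceD x y : W x -> W y -> W (x + y).
Proof. by case: subW => _ s Wx Wy; rewrite -[x]scale1r; apply: s. Qed.

Lemma subspaceZ a x : W x -> W (a *: x).
Proof. by case: subW => W0 s Wx; rewrite -[_ *: _]addr0; apply: s. Qed.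

Lemma subspaceN x : W x -> W (- x).
Proof. by rewrite -scaleN1r; apply: subspaceZ. Qed.

Lemma subspaceB x y : W x -> W y -> W (x - y).
Proof. by move=> Wx Wy; apply: subspaceD => //; apply: subspaceN. Qed.

Lemma subspace_sum (J : Type) (r : seq J) (P : pred J) (F : J -> M) :
  (forall j, P j -> W (F j)) -> W (\sum_(j <- r | P j) F j).
Proof.
by move=> WF; elim/big_ind: _ => //; [apply: subspace0 | apply: subspaceD].
Qed.

Lemma subspace_sum_seq (J : eqType) (r : seq J) (F : J -> M) :
  (forall j, j \in r -> W (F j)) -> W (\sum_(j <- r) F j).
Proof.
by move=> WF; rewrite big_seq; apply: subspace_sum.
Qed.

End Subspace.

Lemma lspan_subspace A : subspace (lspan A).
Proof.
split=> [|a _ _ [n [c [x [Ax ->]]]] [m [d [y [Ay ->]]]]].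
  exists 0%N, (fun=> 0), (fun=> 0); split; first by case.
  by rewrite big_ord0.
exists (n + m)%N, (fun j : 'I_(n + m) =>
    match fintype.split j with inl k => a * c k | inr k => d k end),
  (fun j : 'I_(n + m) => match fintype.split j with inl k => x k | inr k => y k end).
split=> [j|]; first by case: (fintype.split j).
rewrite big_split_ord scaler_sumr; congr (_ + _); apply: eq_bigr => j _.
  by rewrite (unsplitK (inl j)) scalerA.
by rewrite (unsplitK (inr j)).
Qed.

Lemma lspan_gen A x : A x -> lspan A x.
Proof.
by move=> Ax; exists 1%N, (fun=> 1), (fun=> x); rewrite big_ord1 scale1r.
Qed.

Lemma lspan_min A W : subspace W -> A `<=` W -> lspan A `<=` W.
Proof.
move=> sW AW _ [n [c [x [Ax ->]]]].
by apply: subspace_sum => // j _; apply: subspaceZ => //; apply/AW/Ax.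
Qed.

Lemma lspan_mono A B : A `<=` B -> lspan A `<=` lspan B.
Proof.
move=> AB; apply: lspan_min (lspan_subspace _) _ => x /AB; exact: lspan_gen.
Qed.

Lemma lspan_le A B : A `<=` lspan B -> lspan A `<=` lspan B.
Proof. exact: lspan_min (lspan_subspace _). Qed.

Lemma lspan_seq (s : seq M) x :
  lspan [set` s] x -> exists c : 'I_(size s) -> K,
    x = \sum_(j < size s) c j *: s`_j.
Proof.
pose W := [set x | exists c : 'I_(size s) -> K, x = \sum_(j < size s) c j *: s`_j].
apply: (@lspan_min _ W) => [|y /= ys].
  split=> [|a _ _ [c ->] [d ->]].
    by exists (fun=> 0); rewrite big1 // => j _; rewrite scale0r.
  exists (fun j => a * c j + d j); rewrite scaler_sumr -big_split.
  by apply: eq_bigr => j _; rewrite /= scalerDl scalerA.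
have lt_y : (index y s < size s)%N by rewrite index_mem.
exists (fun j => (j == Ordinal lt_y)%:R).
rewrite (bigD1 (Ordinal lt_y)) //= eqxx scale1r nth_index // big1 ?addr0 //.
by move=> j /negPf->; rewrite scale0r.
Qed.

Lemma fin_dimP W : fin_dim W <-> exists s : seq M, W `<=` lspan [set` s].
Proof.
split=> [[n [e We]]|[s Ws]].
  exists [seq e j | j <- enum 'I_n] => w /We[c ->].
  exists n, c, e; split=> // j /=; apply/mapP; exists j => //.
  by rewrite mem_enum.
by exists (size s), (fun j => s`_j) => w /Ws /lspan_seq.
Qed.

Lemma fin_dim_sub A B : A `<=` B -> fin_dim B -> fin_dim A.
Proof. by move=> AB [n [e Be]]; exists n, e => w /AB /Be. Qed.

Lemma fin_dim_lspan A : fin_dim A -> fin_dim (lspan A).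
Proof.
move=> /fin_dimP[s As]; apply/fin_dimP; exists s; exact: lspan_le.
Qed.

Lemma fin_dim_set1 (v : M) : fin_dim [set v].
Proof.
apply/fin_dimP; exists [:: v] => _ ->; apply: lspan_gen => /=.
by rewrite inE.
Qed.

Lemma fin_dim_setU A B : fin_dim A -> fin_dim B -> fin_dim (A `|` B).
Proof.
move=> /fin_dimP[s As] /fin_dimP[t Bt]; apply/fin_dimP; exists (s ++ t).
move=> x [/As|/Bt]; apply: lspan_mono => y /=; rewrite mem_cat => ->//.
by rewrite orbT.
Qed.

Lemma fin_dim_bigcup (J : eqType) (r : seq J) (F : J -> set M) :
  (forall j, j \in r -> fin_dim (F j)) -> fin_dim (\bigcup_(j in [set` r]) F j).
Proof.
elim: r => [|j r IH] fF.
  by apply/fin_dimP; exists [::] => x [].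
apply: (@fin_dim_sub _ (F j `|` \bigcup_(k in [set` r]) F k)); last first.
  apply: fin_dim_setU; first by apply: fF; rewrite mem_head.
  by apply: IH => k kr; apply: fF; rewrite inE kr orbT.
move=> x [k /=]; rewrite inE => /orP[/eqP->|kr] Fx; first by left.
by right; exists k.
Qed.

(** More vectors than coordinates: the kernel of the coordinate matrix gives
    the relation. *)
Lemma fin_dim_dependent W : fin_dim W -> exists n, forall x : 'I_n.+1 -> M,
  (forall j, W (x j)) -> exists c : 'I_n.+1 -> K,
  (exists j, c j != 0) /\ \sum_(j < n.+1) c j *: x j = 0.
Proof.
move=> [n [e We]]; exists n => x Wx.
have [a xa] := choice (fun j => We _ (Wx j)).
pose A : 'M[K]_(n.+1, n) := \matrix_(j, k) a j k.
have kA0 : kermx A != 0.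
  by rewrite -mxrank_eq0 mxrank_ker subn_eq0 -ltnNge ltnS rank_leq_col.
pose u := nz_row (kermx A).
have uA : u *m A = 0 by apply/sub_kermxP; exact: nz_row_sub.
have u0 : u != 0 by rewrite nz_row_eq0.
exists (u 0); split.
  apply: contrapT => /forallNP u00; case/negP: u0; apply/eqP/rowP => j.
  by rewrite mxE; apply/eqP/negPn/negP/u00.
under eq_bigr do rewrite xa scaler_sumr.
rewrite exchange_big big1 // => k _.
under eq_bigr do rewrite scalerA.
rewrite -scaler_suml -[X in X *: _]/(\sum_j u 0 j * a j k).
have /rowP/(_ k) := uA; rewrite !mxE => uAk.
by under eq_bigr => j do rewrite -[a j k](mxE matrix_key (fun j k => a j k)) -/A;
  rewrite uAk scale0r.
Qed.

(** A maximal space of coefficient vectors of elements of W gives a spanning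
    list made of elements of W. *)
Lemma fin_dim_spanning W : subspace W -> fin_dim W ->
  exists s : seq M, (forall x, x \in s -> W x) /\ W `<=` lspan [set` s].
Proof.
move=> sW [n [e We]].
pose f (c : 'rV[K]_n) := \sum_j c 0 j *: e j.
have f_lin : linear f.
  move=> a c d; rewrite /f scaler_sumr -big_split; apply: eq_bigr => j _ /=.
  by rewrite !mxE scalerDl scalerA.
pose F : {linear 'rV[K]_n -> M} := HB.pack f (GRing.isLinear.Build _ _ _ _ f f_lin).
pose P d := `[< exists U : {vspace 'rV[K]_n},
  \dim U = d /\ forall c, c \in U -> W (f c) >].
have exP : exists d, P d.
  exists 0%N; apply/asboolP; exists 0%VS; rewrite dimv0; split=> // c.
  rewrite memv0 => /eqP->; rewrite -[f 0]/(F 0) linear0.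
  exact: subspace0.
have Pn d : P d -> (d <= n)%N.
  move=> /asboolP[U [<- _]]; rewrite (leq_trans (dimvS (subvf U))) //.
  by rewrite dimvf /dim /= mul1n.
have [d /asboolP[U [dU UW]] Umax] := ex_maxnP exP Pn.
exists [seq f c | c <- vbasis U]; split.
  by move=> _ /mapP[c /vbasis_mem cU ->]; apply: UW.
move=> w Ww; have [c wc] := We w Ww.
have {wc}wc : w = f (\row_j c j).
  by rewrite wc; apply: eq_bigr => j _; rewrite mxE.
set r := \row_j c j in wc.
have rU : r \in U.
  have : (U + <[r]> <= U)%VS.
    rewrite -(geq_leqif (dimv_leqif_sup (addvSl U <[r]>))) dU.
    apply: Umax; apply/asboolP; exists (U + <[r]>)%VS; split=> // c'.
    move=> /memv_addP[c1 Uc1 [_ /vlineP[a ->] ->]].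
    rewrite -[f _]/(F _) linearD linearZ /=.
    by apply: subspaceD => //; [apply: UW | apply: subspaceZ; rewrite -?wc].
  by move=> /subvP; apply; apply: subvP (addvSr U <[r]>) _ (memv_line r).
rewrite wc (coord_vbasis rU) -[f _]/(F _) linear_sum /=.
apply: (subspace_sum (lspan_subspace _)) => j _.
rewrite -[f _]/(F _) linearZ /=.
apply: (subspaceZ (lspan_subspace _)); apply: lspan_gen.
by apply: map_f; rewrite mem_nth // size_tuple.
Qed.

End Spans.

(** * Weight spaces of commuting operators *)

Section Families.
Variables (K : fieldType) (M : lmodType K).

Lemma lspan_bigcup_family (I : eqType) (F : I -> set M) (v : M) :
  (forall i, subspace (F i)) -> lspan (\bigcup_i F i) v ->
  exists (s : seq I) (x : I -> M),
    [/\ uniq s, forall i, F i (x i) & v = \sum_(i <- s) x i].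
Proof.
move=> sF [n [c [y [Fy ->]]]].
have /choice[a Fa] : forall j, exists k, F k (y j).
  by move=> j; have [k _ Fk] := Fy j; exists k.
exists (undup [seq a j | j <- enum 'I_n]), (fun k => \sum_(j | a j == k) c j *: y j).
split=> [|k|]; first exact: undup_uniq.
  by apply: subspace_sum => // j /eqP<-; apply: subspaceZ.
under [RHS]eq_bigr => k _ do rewrite big_mkcond /=.
rewrite [RHS]exchange_big /=; apply: eq_bigr => j _.
rewrite (bigD1_seq (a j)) ?undup_uniq //=; last first.
  by rewrite mem_undup map_f // mem_enum.
by rewrite eqxx big1 ?addr0 // => k; rewrite eq_sym => /negPf->.
Qed.

End Families.

Section WeightVectors.
Variables (K : fieldType) (h : vectType K) (M : lmodType K) (T : h -> M -> M).
Hypothesis T_lin : forall t, linear (T t).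
Local Notation dual := 'Hom(h, K^o).
Implicit Types (W : set M) (alpha : dual).

Definition wvectors W alpha : set M :=
  [set v | W v /\ forall t : h, T t v = alpha t *: v].

Definition T_stable W := forall t v, W v -> W (T t v).

Let TL t : {linear M -> M} := HB.pack (T t) (GRing.isLinear.Build _ _ _ _ (T t) (T_lin t)).

Lemma op_sum t (J : Type) (r : seq J) (P : pred J) (F : J -> M) :
  T t (\sum_(j <- r | P j) F j) = \sum_(j <- r | P j) T t (F j).
Proof. exact: (linear_sum (TL t)). Qed.

Lemma opD t u v : T t (u + v) = T t u + T t v.
Proof. exact: (linearD (TL t)). Qed.

Lemma opZ t a v : T t (a *: v) = a *: T t v.
Proof. exact: (linearZ_LR (TL t)). Qed.

Lemma op0 t : T t 0 = 0.
Proof. exact: (linear0 (TL t)). Qed.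

Lemma wvectors_subspace W alpha : subspace W -> subspace (wvectors W alpha).
Proof.
move=> sW; split=> [|a x y [Wx wx] [Wy wy]].
  by split=> [|t]; [apply: subspace0 | rewrite op0 scaler0].
split=> [|t]; first by apply: subspaceD => //; apply: subspaceZ.
by rewrite T_lin wx wy scalerDr !scalerA mulrC.
Qed.

(** Applying T t - alpha t kills the component of weight alpha and, for a
    suitable t, multiplies any other given component by a nonzero scalar. The
    family of weights is indexed so that it may be given by a list as well as by
    a numbering. *)
Lemma weight_component_mem W (I : eqType) (wt : I -> dual) (s : seq I)
    (x : I -> M) : subspace W -> T_stable W -> uniq s ->
  {in s &, injective wt} ->
  (forall k, k \in s -> forall t, T t (x k) = wt k t *: x k) ->
  W (\sum_(k <- s) x k) -> forall k, k \in s -> W (x k).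
Proof.
move=> sW TW; elim: s x => [//|j s IH] x /= /andP[js us] inj wx.
rewrite big_cons => Wsum.
have inj' : {in s &, injective wt}.
  by move=> k l ks ls; apply: inj; rewrite inE ?ks ?ls orbT.
have wxs k : k \in s -> forall t, T t (x k) = wt k t *: x k.
  by move=> ks; apply: wx; rewrite inE ks orbT.
have Ws k : k \in s -> W (x k).
  move=> ks; have [t nz] : exists t, wt k t != wt j t.
    apply: contrapT => /forallNP eq_kj; case/negP: js.
    rewrite -(inj k j) ?mem_head ?inE ?ks ?orbT //.
    by apply/lfunP => t; have /negP/negPn/eqP := eq_kj t.
  suff: W ((wt k t - wt j t) *: x k).
    move/(subspaceZ sW (wt k t - wt j t)^-1).
    by rewrite scalerA mulVf ?scale1r // subr_eq0.
  apply: (IH (fun k => (wt k t - wt j t) *: x k)) => // [l ls u|].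
    by rewrite opZ wxs // !scalerA mulrC.
  have := subspaceB sW (TW t _ Wsum) (subspaceZ sW (wt j t) Wsum).
  rewrite opD wx ?mem_head // scalerDr opprD addrACA subrr add0r op_sum.
  rewrite scaler_sumr -sumrB; congr (W _); apply: eq_big_seq => l ls.
  by rewrite scalerBl wxs.
move=> k; rewrite inE => /orP[/eqP->|/Ws//].
have := subspaceB sW Wsum (subspace_sum_seq sW Ws).
by rewrite addrK.
Qed.

(** The case of the zero subspace: weight vectors of distinct weights are
    independent. *)
Lemma weight_component_eq0 (s : seq dual) (x : dual -> M) : uniq s ->
  (forall alpha, alpha \in s -> forall t, T t (x alpha) = alpha t *: x alpha) ->
  \sum_(alpha <- s) x alpha = 0 -> forall alpha, alpha \in s -> x alpha = 0.
Proof.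
move=> us wx sum0; apply: (@weight_component_mem [set 0] _ id) => //.
  by split=> // a u v -> ->; rewrite scaler0 addr0.
by move=> t v ->; rewrite op0.
Qed.

Lemma wvectors_direct_sum W : subspace W ->
  W `<=` lspan (\bigcup_alpha wvectors W alpha) -> direct_sum (wvectors W) W.
Proof.
move=> sW gen; split=> [alpha|w /gen|s x us wx].
- by split=> [|v []//]; apply: wvectors_subspace.
- case/lspan_bigcup_family => [alpha|s [x [_ Wx ->]]].
    exact: wvectors_subspace.
  by exists s, x; split.
by apply: weight_component_eq0 => // alpha /wx[].
Qed.

(** A stable subspace of a sum of weight spaces contains the components of its
    vectors, so it is a sum of weight spaces as well. *)
Lemma wvectors_gen_sub W W' : subspace W -> T_stable W -> W `<=` W' ->
  subspace W' ->
  W' `<=` lspan (\bigcup_alpha wvectors W' alpha) ->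
  W `<=` lspan (\bigcup_alpha wvectors W alpha).
Proof.
move=> sW TW WW' sW' gen w Ww.
case/lspan_bigcup_family: (gen w (WW' w Ww)) => [alpha|s [x [us wx ww]]].
  exact: wvectors_subspace.
rewrite ww; apply: (subspace_sum_seq (lspan_subspace _)) => alpha alphas.
apply: lspan_gen; exists alpha => //; split; last by case: (wx alpha).
apply: (@weight_component_mem W _ id s x) => // [beta _|].
  by case: (wx beta).
by rewrite -ww.
Qed.

(** Eigenvectors for more weights than the dimension allows would satisfy a
    linear relation, against the independence of weight vectors. *)
Lemma fin_dim_finite_weights W : fin_dim W ->
  finite_set [set alpha | exists v, wvectors W alpha v /\ v != 0].
Proof.
move=> /fin_dim_dependent[n dep]; apply: contrapT => infW.
have [B BW nB] := infinite_set_fset n.+1 infW.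
pose b (j : 'I_n.+1) := nth 0 (finmap.enum_fset B) j.
have ltB (j : 'I_n.+1) : (j < size (finmap.enum_fset B))%N by apply: leq_trans (ltn_ord j) nB.
have /choice[x bx] : forall j, exists v, wvectors W (b j) v /\ v != 0.
  by move=> j; apply: BW; apply: mem_nth.
have [c [[j cj0] sum0]] := dep x (fun j => (bx j).1.1).
have b_inj : injective b.
  move=> k l /eqP; rewrite /b nth_uniq ?finmap.fset_uniq // => /eqP; exact: val_inj.
have : c j *: x j = 0.
  apply: (@weight_component_mem [set 0] _ b (enum 'I_n.+1)
    (fun k => c k *: x k)) => //=.
  - by split=> // a u v -> ->; rewrite scaler0 addr0.
  - by move=> t v ->; rewrite op0.
  - exact: enum_uniq.
  - by move=> k l _ _ /b_inj.
  - by move=> k _ t; rewrite opZ (bx k).1.2 !scalerA mulrC.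
  - by rewrite big_enum.
  - by rewrite mem_enum.
by move/eqP; rewrite scaler_eq0 (negPf cj0) (negPf (bx j).2).
Qed.

(** Take the components of the members of a finite spanning list. *)
Lemma weight_spanning W : subspace W -> fin_dim W ->
  W `<=` lspan (\bigcup_alpha wvectors W alpha) ->
  exists s : seq M, (forall x, x \in s -> exists alpha, wvectors W alpha x) /\
    W `<=` lspan [set` s].
Proof.
move=> sW fW gen; have [r [rW Wr]] := fin_dim_spanning sW fW.
suff [s [sW' rs]] : exists s : seq M,
    (forall x, x \in s -> exists alpha, wvectors W alpha x) /\
    [set` r] `<=` lspan [set` s].
  by exists s; split=> // w /Wr; apply: lspan_le.
elim: r rW {Wr} => [|w r IH] rW; first by exists [::].
have [s [sW' rs]] : exists s : seq M,
    (forall x, x \in s -> exists alpha, wvectors W alpha x) /\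
    [set` r] `<=` lspan [set` s].
  by apply: IH => x xr; apply: rW; rewrite inE xr orbT.
have /gen/lspan_bigcup_family[alpha|s' [x [_ wx ->]]] : W w.
- by apply: rW; rewrite mem_head.
- exact: wvectors_subspace.
exists ([seq x alpha | alpha <- s'] ++ s); split.
  by move=> y; rewrite mem_cat => /orP[/mapP[alpha _ ->]|/sW'//]; exists alpha.
have s's : [set` s] `<=` [set` [seq x alpha | alpha <- s'] ++ s].
  by move=> y /=; rewrite mem_cat => ->; rewrite orbT.
move=> y /=; rewrite inE => /orP[/eqP->|yr]; last first.
  by apply: (lspan_mono s's); apply: rs.
apply: (subspace_sum_seq (lspan_subspace _)) => alpha alphas.
by apply: lspan_gen; rewrite /= mem_cat map_f.
Qed.

(** Peeling off one factor f - r: the components of f v - r v for the other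
    eigenvalues r', divided by r' - r, are components of v, and what is left of
    v is an eigenvector for r. *)
Lemma eigen_split (f : M -> M) W (rs : seq K) v : linear f -> subspace W ->
  (forall w, W w -> W (f w)) -> uniq rs -> W v ->
  foldl (fun w r => f w - r *: w) v rs = 0 ->
  exists x : K -> M, (forall r, W (x r) /\ f (x r) = r *: x r) /\
    v = \sum_(r <- rs) x r.
Proof.
move=> f_lin sW fW; have fD u w : f (u + w) = f u + f w.
  by have := f_lin 1 u w; rewrite !scale1r.
have f0 : f 0 = 0 by apply: (addrI (f 0)); rewrite -fD !addr0.
have fZ a u : f (a *: u) = a *: f u by have := f_lin a u 0; rewrite f0 !addr0.
elim: rs v => [|r rs IH] v /=.
  move=> _ _ ->; exists (fun=> 0); split=> [r|]; last by rewrite big_nil.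
  by rewrite f0 scaler0; split=> //; apply: subspace0.
move=> /andP[rrs urs] Wv.
case/(IH _ urs) => [|x [wx vx]].
  by apply: subspaceB => //; [apply: fW | apply: subspaceZ].
pose y r' := (r' - r)^-1 *: x r'.
have wy r' : W (y r') /\ f (y r') = r' *: y r'.
  have [Wx fx] := wx r'; split; first exact: subspaceZ.
  by rewrite fZ fx !scalerA mulrC.
pose z := v - \sum_(k <- rs) y k.
exists (fun r' => if r' == r then z else y r'); split=> [r'|]; last first.
  rewrite big_cons eqxx (eq_big_seq y) ?subrK // => r' r'rs.
  by case: eqP => // rr'; rewrite -rr' r'rs in rrs.
case: eqP => // ->; split.
  by apply: subspaceB => //; apply: subspace_sum => // k _; case: (wy k).
have fN u : f (- u) = - f u by rewrite -scaleN1r fZ scaleN1r.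
have key : f v - r *: v = \sum_(k <- rs) f (y k) - r *: \sum_(k <- rs) y k.
  rewrite vx scaler_sumr -sumrB; apply: eq_big_seq => k krs.
  have [_ ->] := wy k; rewrite -scalerBl scalerA mulfV ?scale1r // subr_eq0.
  by apply: contraNneq rrs => <-.
apply/eqP; rewrite /z fD fN (big_morph f fD f0) scalerBr -subr_eq0.
by rewrite opprD opprK addrACA key addrCA subrK addNr.
Qed.

End WeightVectors.

(** Commuting operators, each diagonalizable on every vector: splitting along
    one operator stays inside the joint eigenspaces of the others, and finitely
    many operators (a basis) suffice. *)
Section SimultaneousDiagonalization.
Variables (K : fieldType) (h : vectType K) (M : lmodType K) (T : h -> M -> M).
Variable W : set M.
Hypotheses (T_lin : forall t, linear (T t)) (sW : subspace W).
Hypothesis TW : T_stable T W.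
Hypothesis T_linl : forall v, W v -> linear (T^~ v).
Hypothesis T_comm : forall t t' v, W v -> T t (T t' v) = T t' (T t v).
Hypothesis T_diag : forall t v, W v -> exists2 rs : seq K, uniq rs &
  foldl (fun w r => T t w - r *: w) v rs = 0.

Lemma joint_eigen_split (ts : seq h) : W `<=` lspan [set w | W w /\
  exists c : h -> K, forall t, t \in ts -> T t w = c t *: w].
Proof.
elim: ts => [|t ts IH] v Wv.
  by apply: lspan_gen; split=> //; exists (fun=> 0).
have := IH v Wv; apply: lspan_min (lspan_subspace _) _ _ => w [Ww [c cw]].
pose W' := [set u | W u /\ forall t', t' \in ts -> T t' u = c t' *: u].
have [rs urs rsw] := T_diag t Ww.
have sW' : subspace W'.
  split=> [|a x y [Wx cx] [Wy cy]].
    by split=> [|t' _]; [apply: subspace0 | rewrite op0 // scaler0].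
  split=> [|t' t's]; first by apply: subspaceD => //; apply: subspaceZ.
  by rewrite T_lin cx ?cy // scalerDr !scalerA mulrC.
have TW' u : W' u -> W' (T t u).
  case=> Wu uu; split=> [|t' t's]; first exact: TW.
  by rewrite T_comm // uu // opZ.
have [x [W'x ->]] := eigen_split (T_lin t) sW' TW' urs (conj Ww cw) rsw.
apply: (subspace_sum (lspan_subspace _)) => r _; apply: lspan_gen.
have [[Wx cx] tx] := W'x r.
split=> //; exists (fun t' => if t' == t then r else c t') => t'.
by rewrite inE; case: eqP => [->|_] //= /cx.
Qed.

Lemma diagonalizable_wvectors : W `<=` lspan (\bigcup_alpha wvectors T W alpha).
Proof.
move=> v /(joint_eigen_split (vbasis {:h})).
apply: lspan_min (lspan_subspace _) _ _ => w [Ww [c cw]].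
pose b := vbasis {:h}.
pose f (t : h) : K^o := \sum_j coord b j t * c b`_j.
have f_lin : linear f.
  move=> a t t'; rewrite /f scaler_sumr -big_split; apply: eq_bigr => j _ /=.
  by rewrite linearP mulrDl -mulrA.
pose F : {linear h -> K^o} := HB.pack f (GRing.isLinear.Build _ _ _ _ f f_lin).
pose Tw : {linear h -> M} :=
  HB.pack (T^~ w) (GRing.isLinear.Build _ _ _ _ (T^~ w) (T_linl Ww)).
apply: lspan_gen; exists (linfun F) => //; split=> // t.
rewrite lfunE /= -[T t w]/(Tw t) {1}(coord_vbasis (memvf t)) linear_sum /=.
rewrite scaler_suml; apply: eq_bigr => j _.
rewrite -[T _ w]/(Tw _) linearZ_LR /= -scalerA; congr (_ *: _).
by apply: cw; rewrite mem_nth // size_tuple.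
Qed.

End SimultaneousDiagonalization.

(** * Modules of a Lie algebra and reordering of products *)

Section LieBasics.
Variables (K : fieldType) (g : lieAlgType K).
Implicit Types x y z : g.

Lemma lieDl x y z : lie (x + y) z = lie x z + lie y z.
Proof. by have := lie_linearl z 1 x y; rewrite !scale1r. Qed.

Lemma lieDr x y z : lie z (x + y) = lie z x + lie z y.
Proof. by have := lie_linearr z 1 x y; rewrite !scale1r. Qed.

Lemma lieC x y : lie x y = - lie y x.
Proof.
have := lie_alternating (x + y).
rewrite lieDl !lieDr !lie_alternating add0r addr0 => /eqP.
by rewrite addr_eq0 => /eqP.
Qed.

Lemma lie0r x : lie x 0 = 0.
Proof. by apply: (addrI (lie x 0)); rewrite -lieDr !addr0. Qed.

Lemma lie0l x : lie 0 x = 0.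
Proof. by rewrite lieC lie0r oppr0. Qed.

Lemma lieNr x y : lie x (- y) = - lie x y.
Proof. by apply: (addrI (lie x y)); rewrite -lieDr !subrr lie0r. Qed.

Lemma lie_module_ad : lie_module (@lie _ g) setT setT.
Proof.
split=> // [x a v w _ _ _|a x y v _ _ _|x y v _ _ _].
- exact: lie_linearr.
- exact: lie_linearl.
rewrite lieC; have /eqP := lie_jacobi x y v.
by rewrite addr_eq0 [lie v x]lieC lieNr => /eqP <-.
Qed.

End LieBasics.

Section Modules.
Variables (K : fieldType) (g : lieAlgType K) (M : lmodType K).
Variables (act : g -> M -> M) (W : set M).
Hypothesis modW : lie_module act setT W.
Implicit Types (x y : g) (v w : M) (G : set g) (A : set M).

Lemma module_subspace : subspace W. Proof. by case: modW. Qed.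
Let sW := module_subspace.

Lemma module_mem x v : W v -> W (act x v).
Proof. by case: modW => _ m _ _ _; apply: m. Qed.

Lemma module_lie x y v : W v ->
  act (lie x y) v = act x (act y v) - act y (act x v).
Proof. by case: modW => _ _ _ _ m Wv; apply: m. Qed.

Lemma module_actD x v w : W v -> W w -> act x (v + w) = act x v + act x w.
Proof.
case: modW => _ _ m _ _ Wv Ww; have := m x 1 v w I Wv Ww.
by rewrite !scale1r.
Qed.

Lemma module_act0 x : act x 0 = 0.
Proof.
have W0 := subspace0 sW.
by apply: (addrI (act x 0)); rewrite -module_actD // !addr0.
Qed.

Lemma module_actZ x a v : W v -> act x (a *: v) = a *: act x v.
Proof.
case: modW => _ _ m _ _ Wv; have := m x a v 0 I Wv (subspace0 sW).
by rewrite module_act0 !addr0.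
Qed.

Lemma module_actB x v w : W v -> W w -> act x (v - w) = act x v - act x w.
Proof.
move=> Wv Ww; have WN := subspaceN sW Ww.
rewrite module_actD //; congr (_ + _).
by rewrite -[- w]scaleN1r module_actZ // scaleN1r.
Qed.

Lemma module_actDl x y v : W v -> act (x + y) v = act x v + act y v.
Proof.
case: modW => _ _ _ m _ Wv; have := m 1 x y v I I Wv.
by rewrite !scale1r.
Qed.

Lemma module_act0l v : W v -> act 0 v = 0.
Proof.
by move=> Wv; apply: (addrI (act 0 v)); rewrite -module_actDl // !addr0.
Qed.

Lemma module_actZl a x v : W v -> act (a *: x) v = a *: act x v.
Proof.
case: modW => _ _ _ m _ Wv; have := m a x 0 v I I Wv.
by rewrite module_act0l // !addr0.
Qed.

Lemma word_mem v (s : seq g) : W v -> W (foldr act v s).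
Proof. by move=> Wv; elim: s => //= x s; apply: module_mem. Qed.

Lemma env_orbit_sub k v : W v -> env_orbit act k v `<=` W.
Proof.
by move=> Wv; apply: lspan_min sW _ => _ [s [_ ->]]; apply: word_mem.
Qed.

(** Bilinearity of the action. *)
Lemma lspan_act G A x w : A `<=` W -> lspan G x -> lspan A w ->
  lspan [set u | exists y v, [/\ G y, A v & u = act y v]] (act x w).
Proof.
move=> AW Gx Aw; set B := (X in lspan X (act x w)).
have sB := lspan_subspace B; have lAW := lspan_min sW AW.
pose C := [set w | W w /\ lspan B (act x w)].
suff AC : lspan A `<=` C by have [] := AC _ Aw.
apply: lspan_min => [|v Av].
  split=> [|a v u [Wv Bv] [Wu Bu]].
    by split; rewrite ?module_act0; apply: subspace0.
  have Wav := subspaceZ sW a Wv.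
  split; first exact: subspaceD.
  by rewrite module_actD // module_actZ //; apply: (proj2 sB).
split; first exact: AW.
pose D := [set x | lspan B (act x v)].
suff : lspan G `<=` D by apply.
apply: lspan_min => [|y Gy]; last by apply: lspan_gen; exists y, v.
have Wv := AW v Av.
split=> [|a y z By Bz]; rewrite /D /= ?module_act0l //; first exact: subspace0.
by rewrite module_actDl // module_actZl //; apply: (proj2 sB).
Qed.

(** Multilinear expansion of a product of operators. *)
Lemma word_lspan G v (s : seq g) : W v -> (forall x, x \in s -> lspan G x) ->
  lspan [set w | exists r : seq g,
    [/\ size r = size s, forall x, x \in r -> G x & w = foldr act v r]]
    (foldr act v s).
Proof.
move=> Wv; elim: s => [|x s IH] sG /=.
  by apply: lspan_gen; exists [::].
have Gx : lspan G x by apply: sG; rewrite mem_head.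
have {}IH := IH (fun y ys => sG y (mem_behead (s := x :: s) ys)).
apply: lspan_mono (lspan_act _ Gx IH) => [_ [y [_ [Gy [r [szr rG ->]] ->]]]|].
  exists (y :: r); split=> //=; first by rewrite szr.
  by move=> z; rewrite inE => /orP[/eqP->//|/rG].
by move=> _ [r [_ _ ->]]; apply: word_mem.
Qed.

Lemma env_orbit_lspan G v : W v ->
  env_orbit act (lspan G) v `<=` env_orbit act G v.
Proof.
move=> Wv; apply: lspan_le => _ [s [sG ->]].
apply: lspan_mono (word_lspan Wv sG) => _ [r [_ rG ->]]; by exists r.
Qed.

Lemma env_orbit_mono k k' v : k `<=` k' -> env_orbit act k v `<=` env_orbit act k' v.
Proof.
move=> kk'; apply: lspan_mono => _ [s [sk ->]].
by exists s; split=> // x /sk /kk'.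
Qed.

Lemma env_orbit_self k v : env_orbit act k v v.
Proof. by apply: lspan_gen; exists [::]. Qed.

Lemma env_orbit_act k x v w : W v -> k x -> env_orbit act k v w ->
  env_orbit act k v (act x w).
Proof.
move=> Wv kx kw.
apply: lspan_mono (lspan_act _ (lspan_gen kx) kw) => [u|].
  move=> [y [_ [ky [s [sk ->]] ->]]]; exists (y :: s); split=> // z.
  by rewrite inE => /orP[/eqP->|/sk].
by move=> _ [s [_ ->]]; apply: word_mem.
Qed.

Section Rearrangement.
Variables (G : set g) (v : M).
Hypotheses (G_lie : forall x y, G x -> G y -> lspan G (lie x y)) (Wv : W v).

Definition short_words n : set M :=
  lspan [set w | exists s : seq g,
    [/\ (size s < n)%N, forall x, x \in s -> G x & w = foldr act v s]].

Lemma short_words_act n x w : lspan G x -> short_words n w ->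
  short_words n.+1 (act x w).
Proof.
move=> Gx nw; apply: lspan_mono (lspan_act _ Gx nw) => [u|].
  move=> [y [_ [Gy [s [sn sG ->]] ->]]]; exists (y :: s); split=> // z.
  by rewrite inE => /orP[/eqP->|/sG].
by move=> _ [s [_ _ ->]]; apply: word_mem.
Qed.

Lemma short_words_gen n (s : seq g) : (size s < n)%N ->
  (forall x, x \in s -> G x) -> short_words n (foldr act v s).
Proof. by move=> sn sG; apply: lspan_gen; exists s. Qed.

(** Moving x across s produces commutators, each of which is a combination of
    generators and thus shortens the product by one factor. *)
Lemma word_move x (s r : seq g) : G x -> (forall y, y \in s ++ r -> G y) ->
  short_words (size (s ++ r)).+1
    (foldr act v (x :: s ++ r) - foldr act v (s ++ x :: r)).
Proof.
move=> Gx; elim: s => [|y s IH] sG /=.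
  by rewrite subrr; apply: subspace0 (lspan_subspace _).
have Gy : G y by apply: sG; rewrite mem_head.
have {}sG z : z \in s ++ r -> G z by move=> zs; apply: sG; rewrite inE zs orbT.
set w := foldr act v (s ++ r).
have Ww : W w by apply: word_mem.
rewrite -(subrK (act y (act x w)) (act x _)) -addrA -module_lie //.
rewrite -module_actB; try by [apply: module_mem | apply: word_mem].
apply: (subspaceD (lspan_subspace _)).
  by apply: short_words_act; [apply: G_lie | apply: short_words_gen].
by apply: short_words_act; [apply: lspan_gen | apply: IH].
Qed.

(** The spanning half of the Poincare-Birkhoff-Witt theorem: reordering a
    product costs only shorter products. *)
Lemma word_perm (s r : seq g) : perm_eq s r -> (forall x, x \in s -> G x) ->
  short_words (size s) (foldr act v s - foldr act v r).
Proof.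
elim: s r => [|x s IH] r.
  move=> /perm_size/esym/size0nil -> _; rewrite subrr.
  exact: subspace0 (lspan_subspace _).
move=> eq_r sG; have xr : x \in r by rewrite -(perm_mem eq_r) mem_head.
case/splitPr: xr eq_r => r1 r2; rewrite -[x :: r2]cat1s.
rewrite perm_sym perm_catCA perm_sym /= perm_cons => eq_s.
have Gx : G x by apply: sG; rewrite mem_head.
have {}sG y : y \in s -> G y by move=> ys; apply: sG; rewrite inE ys orbT.
have szs := perm_size eq_s.
rewrite -(subrK (foldr act v (x :: r1 ++ r2)) (act x (foldr act v s))) -addrA.
apply: (subspaceD (lspan_subspace _)).
  rewrite /= -module_actB; try exact: word_mem.
  by apply: short_words_act; [apply: lspan_gen | apply: IH].
rewrite /= szs; apply: word_move => // y.
by rewrite -(perm_mem eq_s); apply: sG.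
Qed.

End Rearrangement.

Definition act_locally_finite x :=
  forall w, W w -> fin_dim (range (fun n => iter n (act x) w)).

(** The vectors x_1^(n_1) ... x_d^(n_d) v for r = [x_1; ...; x_d]. *)
Definition sorted_words (r : seq g) v : set M :=
  foldr (fun x A => [set w | exists n u, A u /\ w = iter n (act x) u]) [set v] r.

Lemma iter_actD x n v w : W v -> W w ->
  iter n (act x) (v + w) = iter n (act x) v + iter n (act x) w.
Proof.
move=> Wv Ww; have WI u m : W u -> W (iter m (act x) u).
  by move=> Wu; elim: m => //= m; apply: module_mem.
by elim: n => //= n ->; rewrite module_actD //; apply: WI.
Qed.

Lemma iter_act_mem x n v : W v -> W (iter n (act x) v).
Proof. by move=> Wv; elim: n => //= n; apply: module_mem. Qed.

Lemma iter_actZ x n a v : W v -> iter n (act x) (a *: v) = a *: iter n (act x) v.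
Proof.
by move=> Wv; elim: n => //= n ->; rewrite module_actZ //; apply: iter_act_mem.
Qed.

Lemma iter_act0 x n : iter n (act x) 0 = 0.
Proof. by elim: n => //= n ->; apply: module_act0. Qed.

Lemma sorted_words_sub r v : W v -> sorted_words r v `<=` W.
Proof.
move=> Wv; elim: r => [|x r IH] w /=; first by move->.
by move=> [n [u [/IH Wu ->]]]; apply: iter_act_mem.
Qed.

(** One factor at a time: the powers of x applied to a finite spanning list
    span a finite-dimensional space. *)
Lemma sorted_words_fin_dim (r : seq g) v : W v ->
  (forall x, x \in r -> act_locally_finite x) -> fin_dim (sorted_words r v).
Proof.
move=> Wv; elim: r => [|x r IH] rF; first exact: fin_dim_set1.
have {}IH := IH (fun y yr => rF y (mem_behead (s := x :: r) yr)).
have lspanW := lspan_min sW (@sorted_words_sub r v Wv).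
have [e [eA Ae]] := fin_dim_spanning (lspan_subspace _) (fin_dim_lspan IH).
set C := \bigcup_(u in [set` e]) range (fun n => iter n (act x) u).
apply: (@fin_dim_sub _ _ _ (lspan C)); last first.
  apply: fin_dim_lspan; apply: fin_dim_bigcup => u ue.
  by apply: rF; [rewrite mem_head | apply/lspanW/eA].
move=> w [n [u [/(@lspan_gen _ _ _ _)/Ae eu ->]]].
pose D := [set u | W u /\ lspan C (iter n (act x) u)].
suff : lspan [set` e] `<=` D by move=> /(_ u eu)[].
apply: lspan_min => [|u' u'e]; last first.
  by split; [apply/lspanW/eA | apply: lspan_gen; exists u' => //; exists n].
split=> [|a u1 u2 [W1 D1] [W2 D2]].
  split; first exact: subspace0.
  by rewrite iter_act0; apply: subspace0 (lspan_subspace _).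
have Wa := subspaceZ sW a W1; split; first exact: subspaceD.
by rewrite iter_actD // iter_actZ //; apply: (proj2 (lspan_subspace C)).
Qed.

Lemma sorted_wordsP (r s : seq g) v : (forall x, x \in s -> x \in r) ->
  exists2 s', perm_eq s s' & sorted_words r v (foldr act v s').
Proof.
elim: r s => [|x r IH] s sr.
  by exists [::] => //; case: s sr => // y s /(_ y (mem_head _ _)).
case: (IH [seq y <- s | predC (pred1 x) y]) => [y|s' ss' rs'].
  by rewrite mem_filter /= => /andP[yx /sr]; rewrite inE (negPf yx).
exists (nseq (count_mem x s) x ++ s').
  rewrite perm_sym; apply: perm_trans (permEl (perm_filterC (pred1 x) s)).
  rewrite perm_sym; apply: perm_cat ss'; rewrite perm_sym.
  rewrite (_ : [seq y <- s | pred1 x y] = nseq (count_mem x s) x) //.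
  rewrite -size_filter; apply/all_pred1P; exact: filter_all.
exists (count_mem x s), (foldr act v s'); split=> //.
by rewrite foldr_cat; elim: (count_mem x s) => //= n ->.
Qed.

(** Every product of members of r is a combination of products sorted along r,
    and the sorted products span a finite-dimensional space, as each factor in
    turn contributes only finitely many dimensions. *)
Lemma locally_finite_orbit (r : seq g) v :
  (forall x y, x \in r -> y \in r -> lspan [set` r] (lie x y)) ->
  (forall x, x \in r -> act_locally_finite x) ->
  W v -> fin_dim (env_orbit act (lspan [set` r]) v).
Proof.
move=> r_lie rF Wv; apply: fin_dim_sub (fin_dim_lspan (sorted_words_fin_dim Wv rF)).
apply: subset_trans (env_orbit_lspan Wv) _; apply: lspan_le.
suff short n : short_words [set` r] v n `<=` lspan (sorted_words r v).
  by move=> _ [s [sr ->]]; apply: (short (size s).+1); apply: short_words_gen.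
elim: n => [|n IH]; first by apply: lspan_le => w [s []].
apply: lspan_le => _ [s [sn sr ->]].
have [s' ss' rs'] := sorted_wordsP v sr.
rewrite -(subrK (foldr act v s') (foldr act v s)).
apply: (subspaceD (lspan_subspace _)); last exact: lspan_gen.
apply: IH; have := word_perm r_lie Wv ss' sr.
apply: lspan_mono => w [t [ts tr wt]]; exists t; split=> //.
by apply: leq_trans ts _; rewrite -ltnS.
Qed.

End Modules.

(** * Strings of weights and sl2-triples *)

Section Strings.
Variables (K : numFieldType) (g : lieAlgType K) (h : vectType K).
Variables (i : {linear h -> g}) (M : lmodType K) (act : g -> M -> M) (W : set M).
Hypothesis modW : lie_module act setT W.
Local Notation dual := 'Hom(h, K^o).
Local Notation gpart := (weight_space i (@lie _ g) setT).
Implicit Types (alpha beta delta : dual) (x y : g) (v : M).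

Lemma weight_act alpha beta x v : gpart alpha x ->
  weight_space i act W beta v -> weight_space i act W (alpha + beta) (act x v).
Proof.
move=> [_ ax] [Wv bv]; split=> [|t]; first exact: (module_mem modW).
have Wt u : W u -> W (act (i t) u) by apply: (module_mem modW).
rewrite -[LHS](subrK (act x (act (i t) v))) -(module_lie modW) // ax bv.
by rewrite (module_actZl modW) // (module_actZ modW) // add_lfunE scalerDl.
Qed.

(** The alpha-string through beta; it is indexed by integers so that strings of
    alpha and of - alpha can be compared. *)
Definition string_pt alpha beta (k : int) : dual := beta + k%:~R *: alpha.

Lemma string_ptE alpha beta k t :
  string_pt alpha beta k t = beta t + k%:~R * alpha t.
Proof. by rewrite /string_pt add_lfunE scale_lfunE. Qed.

Lemma string_pt0 alpha beta : string_pt alpha beta 0 = beta.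
Proof. by rewrite /string_pt scale0r addr0. Qed.

Lemma string_ptD alpha beta k l :
  string_pt alpha (string_pt alpha beta k) l = string_pt alpha beta (k + l).
Proof. by rewrite /string_pt -addrA -scalerDl intrD. Qed.

Lemma string_pt_opp alpha beta k :
  string_pt (- alpha) beta k = string_pt alpha beta (- k).
Proof. by rewrite /string_pt scalerN -scaleNr mulrNz. Qed.

Lemma iter_weight alpha beta x v (n : nat) : gpart alpha x ->
  weight_space i act W beta v ->
  weight_space i act W (string_pt alpha beta n) (iter n (act x) v).
Proof.
move=> ax bv; elim: n => [|n IH] /=; first by rewrite string_pt0.
have -> : string_pt alpha beta n.+1 = alpha + string_pt alpha beta n.
  by rewrite /string_pt -addn1 PoszD intrD scalerDl scale1r addrA addrC.
exact: weight_act.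
Qed.

Lemma string_bounded (S : set dual) alpha beta : finite_set S -> alpha != 0 ->
  exists N : nat, forall k, S (string_pt alpha beta k) -> (`|k| <= N)%N.
Proof.
move=> /finite_seqP[s ->] alpha0; elim: s => [|sigma s [N sN]].
  by exists 0%N.
have [[k0 k0s]|nk] := pselect (exists k, string_pt alpha beta k = sigma).
  exists (maxn `|k0| N) => k /=; rewrite inE leq_max => /orP[/eqP ks|/sN->].
    have /eqP := etrans ks (esym k0s).
    rewrite (inj_eq (addrI _)) -subr_eq0 -scalerBl scaler_eq0 (negPf alpha0).
    by rewrite orbF subr_eq0 eqr_int => /eqP->; rewrite leqnn.
  by rewrite orbT.
exists N => k /=; rewrite inE => /orP[/eqP ks|/sN//].
by case: nk; exists k.
Qed.

(** The weights along a string of nonzero direction are distinct, so only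
    finitely many powers can survive. *)
Lemma weight_nilpotent alpha beta x v :
  finite_set (weights i act W) -> alpha != 0 -> gpart alpha x ->
  weight_space i act W beta v -> exists n, iter n (act x) v = 0.
Proof.
move=> fW alpha0 ax bv; have [N wN] := string_bounded beta fW alpha0.
exists N.+1; apply/eqP/negPn/negP => nz.
have := wN N.+1; rewrite /= ltnn => wN'; suff : false by [].
by apply: wN'; exists (iter N.+1 (act x) v); split=> //; apply: iter_weight.
Qed.

(** The identity 2 x y^(k+1) v = (k+1) (2 delta(s) - k alpha(s)) y^k v, read
    at the last nonzero power of y. *)
Lemma highest_weight_half alpha delta x y s v n : gpart (- alpha) y ->
  lie x y = i s -> weight_space i act W delta v -> v != 0 ->
  act x v = 0 -> iter n (act y) v = 0 ->
  exists m : nat, 2 * delta s = m%:R * alpha s /\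
    forall k : nat, (k <= m)%N -> iter k (act y) v != 0.
Proof.
move=> ay xy dv v0 xv0 yn0.
have yk (k : nat) : weight_space i act W (string_pt (- alpha) delta k) (iter k (act y) v).
  exact: iter_weight.
have Wyk k : W (iter k (act y) v) by case: (yk k).
have xyk (k : nat) : 2 *: act x (iter k.+1 (act y) v) =
    (k.+1%:R * (2 * delta s - k%:R * alpha s)) *: iter k (act y) v.
  have step (j : nat) : act x (iter j.+1 (act y) v) = act y (act x (iter j (act y) v))
      + (delta s - j%:R * alpha s) *: iter j (act y) v.
    rewrite /= -[LHS](subrK (act y (act x (iter j (act y) v)))) addrC.
    rewrite -(module_lie modW) // xy; congr (_ + _).
    have [_ ->] := yk j; rewrite string_ptE opp_lfunE mulrN.
    by rewrite -pmulrn.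
  elim: k => [|k IH].
    rewrite step /= xv0 (module_act0 modW) add0r !mul0r !subr0 mul1r.
    by rewrite scalerA.
  rewrite step scalerDr -(module_actZ modW); last exact: (module_mem modW).
  rewrite IH (module_actZ modW) // scalerA -[act y _]/(iter k.+1 (act y) v).
  rewrite -scalerDl; congr (_ *: _).
  by rewrite -[k.+2]addn2 -[k.+1]addn1 !natrD; ring.
have exn : exists n, iter n (act y) v == 0 by exists n; apply/eqP.
case: (ex_minnP exn) => -[|m] ym0 mmin; first by rewrite /= (negPf v0) in ym0.
exists m; split=> [|k km]; last first.
  by apply/negP => /mmin; rewrite ltnNge km.
have := xyk m; rewrite (eqP ym0) (module_act0 modW) scaler0 => /esym/eqP.
rewrite scaler_eq0 mulf_eq0 pnatr_eq0 /= subr_eq0 => /orP[/eqP//|/mmin].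
by rewrite ltnn.
Qed.

Section Ends.
Variables (alpha beta : dual).

Definition on_string (k : int) : Prop :=
  exists v, weight_space i act W (string_pt alpha beta k) v /\ v != 0.

Definition string_ends (a b : nat) : Prop :=
  [/\ on_string a, on_string (- b%:Z) &
      forall k, on_string k -> (- b%:Z <= k <= a%:Z)].

Lemma string_ends_exist : finite_set (weights i act W) -> alpha != 0 ->
  on_string 0 -> exists a b, string_ends a b.
Proof.
move=> fW alpha0 p0; have [N pN] := string_bounded beta fW alpha0.
have boundP (f : nat -> int) : (forall n, `|f n|%N = n) -> f 0%N = 0 ->
    exists a : nat, on_string (f a) /\ forall n, on_string (f n) -> (n <= a)%N.
  move=> fE f0; pose P n := `[< on_string (f n) >].
  have exP : exists n, P n by exists 0%N; apply/asboolP; rewrite f0.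
  have Pn n : P n -> (n <= N)%N by move=> /asboolP/pN; rewrite fE.
  have [a /asboolP pa amax] := ex_maxnP exP Pn.
  by exists a; split=> // n /asboolP/amax.
have [//||a [pa amax]] := boundP Posz; first by [].
have [|//|b [pb bmax]] := boundP (fun n => - n%:Z); first by move=> n; rewrite abszN.
exists a, b; split=> // -[n|n] pn.
  by rewrite lez_nat amax // andbT (le_trans (y := 0)) // oppr_le0.
by rewrite NegzE lerN2 lez_nat (bmax n.+1) -?NegzE.
Qed.

(** Both ends of the string are extremal. If alpha(s) != 0, the descents from
    either end both have length a + b, which locates beta(s) independently of x
    and y; if alpha(s) = 0, either end gives beta(s) = 0. *)
Lemma string_eigenvalue a b x y s : string_ends a b ->
  gpart alpha x -> gpart (- alpha) y -> lie x y = i s ->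
  2 * beta s = (b%:R - a%:R) * alpha s.
Proof.
move=> [[v [av v0]] [w [bw w0]] ends] ax ay xy.
have xv0 : act x v = 0.
  apply/eqP/negPn/negP => nz.
  have /ends : on_string (Posz a + 1).
    exists (act x v); split=> //; rewrite -string_ptD.
    rewrite /string_pt mulr1z scale1r addrC; exact: weight_act.
  by rewrite gerDl andbF.
have yw0 : act y w = 0.
  apply/eqP/negPn/negP => nz.
  have /ends : on_string (- b%:Z - 1).
    exists (act y w); split=> //; rewrite -string_ptD.
    rewrite [string_pt _ _ (- 1)]/string_pt mulrN1z scaleN1r addrC.
    exact: weight_act.
  by rewrite lerDl.
have ypt k : iter k (act y) v != 0 -> on_string (a%:Z - k%:Z).
  move=> nz; exists (iter k (act y) v); split=> //.
  by rewrite -string_ptD -string_pt_opp; apply: iter_weight.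
have xpt k : iter k (act x) w != 0 -> on_string (- b%:Z + k%:Z).
  move=> nz; exists (iter k (act x) w); split=> //.
  by rewrite -string_ptD; apply: iter_weight.
have yb k : iter k (act y) v != 0 -> (k <= a + b)%N.
  by move/ypt/ends; lia.
have xb k : iter k (act x) w != 0 -> (k <= a + b)%N.
  by move/xpt/ends; lia.
have [|m [mE my]] := highest_weight_half (n := (a + b).+1) ay xy av v0 xv0.
  by apply/eqP/negPn/negP => /yb; rewrite ltnn.
have [|||m' [m'E m'x]] := @highest_weight_half
    (- alpha) _ y x (- s) w (a + b).+1 _ _ bw w0 yw0.
- by rewrite opprK.
- by rewrite lieC xy linearN.
- by apply/eqP/negPn/negP => /xb; rewrite ltnn.
have lem := yb m (my m (leqnn m)); have lem' := xb m' (m'x m' (leqnn m')).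
move: mE m'E; rewrite !string_ptE opp_lfunE !linearN /= opprK mulrNz -!pmulrn.
move=> mE m'E.
have [as0|as0] := eqVneq (alpha s) 0.
  by move: mE; rewrite as0 !mulr0 addr0.
have sumE : ((m + m')%N%:R : K) = (2 * (a + b))%N%:R.
  apply: (mulIf as0); rewrite natrD mulrDl -mE -m'E natrM natrD; ring.
move/eqP: sumE; rewrite eqr_nat => /eqP sumE.
have ma : m = (a + b)%N by lia.
apply: (addIr (2 * (a%:R * alpha s))); rewrite -mulrDr mE ma natrD; ring.
Qed.

End Ends.

Lemma last_nonzero_iter x v n : v != 0 -> iter n (act x) v = 0 ->
  exists a, iter a (act x) v != 0 /\ act x (iter a (act x) v) = 0.
Proof.
move=> v0 xn; have exn : exists n, iter n (act x) v == 0 by exists n; apply/eqP.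
case: (ex_minnP exn) => -[|a] xa0 amin; first by rewrite /= (negPf v0) in xa0.
exists a; split; last by apply/eqP.
by apply/negP => /amin; rewrite ltnn.
Qed.

(** Climb from v by a steps of x, or b steps of y, to an extremal vector, and let
    m and m' be the lengths of the descents from there. Then beta(t) = m - 2 a
    and beta(t) = 2 b - m'; one of the two descents passes through the reflected
    weight, according to the sign of beta(t). *)
Lemma weight_reflection alpha beta x y t v :
  gpart alpha x -> gpart (- alpha) y -> lie x y = i t -> alpha t = 2 ->
  (forall delta w, weight_space i act W delta w ->
     (exists n, iter n (act x) w = 0) /\ (exists n, iter n (act y) w = 0)) ->
  weight_space i act W beta v -> v != 0 ->
  exists2 k : int, beta t = k%:~R & on_string alpha beta (- k).
Proof.
move=> ax ay xy at2 nil bv v0.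
have [[n xn] [n' yn]] := nil _ _ bv.
have [a [xa xa0]] := last_nonzero_iter v0 xn.
have [b [yb yb0]] := last_nonzero_iter v0 yn.
have wa := iter_weight a ax bv; have wb := iter_weight b ay bv.
have [[_ _] [p yp]] := nil _ _ wa; have [[q xq] _] := nil _ _ wb.
have [m [mE my]] := highest_weight_half ay xy wa xa xa0 yp.
have [||m' [m'E m'x]] := @highest_weight_half (- alpha) _ y x (- t) _ q _ _ wb yb yb0 xq.
- by rewrite opprK.
- by rewrite lieC xy linearN.
move: mE m'E; rewrite !string_ptE opp_lfunE !linearN /= at2 -!pmulrn => mE m'E.
have two0 : (2 : K) != 0 by rewrite pnatr_eq0.
have {}mE : beta t = (m%:Z - 2 * a%:Z)%:~R.
  apply: (mulfI two0); rewrite rmorphB rmorphM /=.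
  apply: (addIr (2 * (a%:R * 2))); rewrite -mulrDr mE -!pmulrn. ring.
have {}m'E : beta t = (2 * b%:Z - m'%:Z)%:~R.
  apply: (mulfI two0); rewrite rmorphB rmorphM /=.
  rewrite -!pmulrn mulrBr [2 * m'%:R]mulrC.
  have -> : m'%:R * 2 = 2 * (- beta t + b%:R * - (-2)) :> K.
    by rewrite m'E opprK.
  ring.
have eqk : m%:Z - 2 * a%:Z = 2 * b%:Z - m'%:Z.
  by apply/eqP; rewrite -(eqr_int K) -mE -m'E.
exists (m%:Z - 2 * a%:Z) => //.
have [am|ma] := leqP a m.
  exists (iter (m - a) (act y) (iter a (act x) v)); split; last first.
    by apply: my; rewrite leq_subr.
  have -> : - (m%:Z - 2 * a%:Z) = a%:Z + - (m - a)%N%:Z by lia.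
  by rewrite -string_ptD -string_pt_opp; apply: iter_weight.
exists (iter (m' - b) (act x) (iter b (act y) v)); split; last first.
  by apply: m'x; rewrite leq_subr.
have -> : - (m%:Z - 2 * a%:Z) = - b%:Z + (m' - b)%N%:Z by lia.
by rewrite -string_ptD -string_pt_opp; apply: iter_weight.
Qed.

(** With x y v = [x, y] v + y x v, each application of x either spends one of the
    n applications of ad x that y survives or one of the m that v survives. *)
Lemma nilpotent_act x y v n m : iter n (lie x) y = 0 ->
  iter m (act x) v = 0 -> W v -> iter (n + m) (act x) (act y v) = 0.
Proof.
have [N] := ubnP (n + m); elim: N n m y v => // N IH n m y v.
case: n => [_ /= -> _ Wv|n]; first by rewrite (module_act0l modW) // (iter_act0 modW).
case: m => [_ _ /= -> _|m]; first by
  rewrite (module_act0 modW) (iter_act0 modW) ?(module_act0 modW).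
move=> ltN; rewrite iterSr => yn; rewrite iterSr => vm Wv.
have Wxv := module_mem modW x Wv.
have e1 : iter (n + m.+1) (act x) (act (lie x y) v) = 0.
  by apply: IH => //; rewrite iterSr.
have e2 : iter (n + m.+1) (act x) (act y (act x v)) = 0.
  by rewrite -addSnnS; apply: IH => //; rewrite ?iterSr // addSnnS.
rewrite addSn iterSr -[act x (act y v)](subrK (act y (act x v))).
rewrite -(module_lie modW) // (iter_actD modW) ?e1 ?e2 ?addr0 //.
  exact: (module_mem modW).
exact: (module_mem modW).
Qed.

End Strings.

(** * The enveloping algebra is generated by the Lie algebra *)

Section EnvelopingAlgebra.
Variables (K : fieldType) (g : lieAlgType K) (U : algType K).
Variable iota : {linear g -> U}.

Definition lmul (x : g) (D : U) : U := iota x * D.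

Lemma lmul_word (s : seq g) D : foldr lmul D s = foldr lmul 1 s * D.
Proof. by elim: s => [|x s IH] /=; rewrite ?mul1r // /lmul IH mulrA. Qed.

(** Boolean, so that the subalgebra generated by g becomes an algebra type to
    which the universal property applies. *)
Definition generated : pred U := fun D => `[< env_orbit lmul setT 1 D >].

Lemma generated_subalg_closed : GRing.subalg_closed generated.
Proof.
have sub := lspan_subspace
  [set w | exists s : seq g, (forall x, x \in s -> [set: g] x) /\ w = foldr lmul 1 s].
split=> [|a u v|u v].
- by apply/asboolP; apply: env_orbit_self.
- by move=> /asboolP Su /asboolP Sv; apply/asboolP; apply: (proj2 sub).
move=> /asboolP [n [c [x [sx ->]]]] /asboolP [m [d [y [sy ->]]]].
apply/asboolP; rewrite mulr_suml; apply: (subspace_sum sub) => j _.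
rewrite mulr_sumr; apply: (subspace_sum sub) => k _.
rewrite -scalerAl -scalerAr; do 2!apply: (subspaceZ sub).
have [s [_ ->]] := sx j; have [r [_ ->]] := sy k.
by rewrite -lmul_word -foldr_cat; apply: lspan_gen; exists (s ++ r).
Qed.

HB.instance Definition _ :=
  GRing.isSubalgClosed.Build K U generated generated_subalg_closed.

Record generated_type := Generated { gen_val : U; _ : gen_val \in generated }.

HB.instance Definition _ := [isSub for gen_val].
HB.instance Definition _ := [Choice of generated_type by <:].
HB.instance Definition _ := [SubChoice_isSubAlgebra of generated_type by <:].

Hypothesis U_env : universal_enveloping iota.

Lemma lie_module_lmul : lie_module lmul setT setT.
Proof.
split=> // [x a v w _ _ _|a x y v _ _ _|x y v _ _ _].
- by rewrite /lmul mulrDr scalerAr.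
- by rewrite /lmul linearP mulrDl scalerAl.
by rewrite /lmul (proj1 U_env) mulrBl !mulrA.
Qed.

Lemma iota_generated x : iota x \in generated.
Proof. by apply/asboolP/lspan_gen; exists [:: x]; split=> //=; rewrite /lmul mulr1. Qed.

(** The subalgebra generated by g receives a map from U; composed with the
    inclusion, it is the identity of U by the uniqueness clause. *)
Lemma enveloping_generated (D : U) : env_orbit lmul setT 1 D.
Proof.
pose f x : generated_type := Generated (iota_generated x).
have f_lin : linear f.
  by move=> a x y; apply: val_inj; rewrite /= linearP.
pose fL : {linear g -> generated_type} :=
  HB.pack f (GRing.isLinear.Build _ _ _ _ f f_lin).
have f_lie x y : fL (lie x y) = fL x * fL y - fL y * fL x.
  by apply: val_inj; rewrite /= (proj1 U_env).
have [F [FE _]] := proj2 U_env _ fL f_lie.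
have [F0 [_ F0u]] := proj2 U_env _ iota (proj1 U_env).
pose vF (x : U) : U := gen_val (F x).
have vF_lin : linear vF by move=> a x y; rewrite /vF !linearP.
have vF_mul : GRing.monoid_morphism vF by split=> [|x y]; rewrite /vF ?rmorph1 ?rmorphM.
have e1 := F0u (HB.pack vF (GRing.isLinear.Build _ _ _ _ vF vF_lin)
  (GRing.isMonoidMorphism.Build _ _ vF vF_mul)).
have e2 := F0u (HB.pack_for {lrmorphism U -> U} (@idfun U)).
have <- : val (F D) = D.
  by rewrite -[LHS]/(vF D) [LHS]e1 => [|x]; [rewrite -e2 | rewrite /= /vF FE].
exact/asboolP/(valP (F D)).
Qed.

End EnvelopingAlgebra.

(** * The structure of a weakly root graded Lie algebra *)

Lemma direct_sum_gen (K : fieldType) (M : lmodType K) (I : eqType)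
    (F : I -> set M) W : direct_sum F W -> W `<=` lspan (\bigcup_i F i).
Proof.
case=> _ gen _ w /gen[s [x [Fx ->]]].
apply: (subspace_sum_seq (lspan_subspace _)) => k ks.
by apply: lspan_gen; exists k => //; apply: Fx.
Qed.

Lemma functionalZ (K : fieldType) (h : vectType K) (f : 'Hom(h, K^o)) a t :
  f (a *: t) = a * f t.
Proof. exact: linearZ. Qed.

Section GradedStructure.
Variables (R : realType) (g : banachLieType R[i]) (gD : set g).
Variables (h : vectType R[i]) (i : {linear h -> g}).
Variables (VD : vectType R) (Delta : seq VD).
Hypothesis g_graded : weakly_graded gD i Delta.
Local Notation dual := 'Hom(h, R[i]^o).
Local Notation gpart := (graded_part i).
Local Notation Delta_roots := (Defs.roots gD i).
Local Notation ad := (fun t : h => lie (i t)).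
Implicit Types (alpha beta : dual) (x y : g) (t : h).

Let modg := lie_module_ad g.

Lemma ad_linear t : linear (ad t).
Proof. exact: lie_linearr. Qed.

Lemma graded_gen : [set: g] `<=` lspan (\bigcup_alpha gpart alpha).
Proof. by case: g_graded => _ _ [/direct_sum_gen]. Qed.

Lemma graded_finite : finite_set (weights i (@lie _ g) setT).
Proof. by case: g_graded => _ _ []. Qed.

Lemma gD_subspace : subspace gD.
Proof. by case: g_graded => _ [[]]. Qed.

Lemma gD_lie x y : gD x -> gD y -> gD (lie x y).
Proof. by case: g_graded => _ [[_ m] _ _ _ _] _; apply: m. Qed.

Lemma gD_fin_dim : fin_dim gD.
Proof. by case: g_graded => _ []. Qed.

Lemma cartan_gD t : gD (i t).
Proof.
by case: g_graded => _ [_ _ _ [_ [_ hgD _ _]] _] _; apply: hgD; exists t.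
Qed.

Lemma cartan_inj : injective i.
Proof. by case: g_graded => _ [_ _ _ []]. Qed.

Lemma gD_stable : T_stable ad gD.
Proof. by move=> t x; apply: gD_lie; apply: cartan_gD. Qed.

Lemma gD_gen : gD `<=` lspan (\bigcup_alpha root_space gD i alpha).
Proof.
apply: (@wvectors_gen_sub _ _ _ ad ad_linear gD setT) => //.
- exact: gD_subspace.
- exact: gD_stable.
exact: graded_gen.
Qed.

(** The centre is a solvable ideal. *)
Lemma gD_center x : gD x -> (forall y, gD y -> lie x y = 0) -> x = 0.
Proof.
move=> gDx xC; case: (g_graded) => _ [_ _ ss _ _] _.
apply: (ss [set x | gD x /\ forall y, gD y -> lie x y = 0]) => //.
  split=> [|y []//|y z gDy [gDz zC]].
    split=> [|a y z [gDy yC] [gDz zC]].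
      by split=> [|y _]; [apply: subspace0 gD_subspace | rewrite lie0l].
    split; first by apply: (proj2 gD_subspace).
    by move=> w gDw; rewrite lie_linearl yC // zC // scaler0 addr0.
  rewrite lieC zC // oppr0.
  by split=> [|w _]; [apply: subspace0 gD_subspace | rewrite lie0l].
exists 1%N; apply: lspan_min; first by split=> // a y z -> ->; rewrite scaler0 addr0.
by move=> _ [y [z [[gDy yC] [[gDz _] ->]]]]; apply: yC.
Qed.

(** On each weight space of g both elements act by scalars, so their bracket
    is central in g_Delta. *)
Lemma cartan_abelian t t' : lie (i t) (i t') = 0.
Proof.
apply: gD_center => [|y gDy]; first exact: gD_lie (cartan_gD _) (cartan_gD _).
have : lspan (\bigcup_alpha gpart alpha) y by apply: graded_gen.
pose C := [set y | lie (lie (i t) (i t')) y = 0].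
apply: (@lspan_min _ _ _ C) => [|x [alpha _ [_ ax]]].
  split=> [|a u v Cu Cv]; first exact: lie0r.
  by rewrite /C /= lie_linearr Cu Cv scaler0 addr0.
rewrite /C /= (module_lie modg) // !ax !(module_actZ modg) // !ax !scalerA.
by rewrite mulrC subrr.
Qed.

(** The Cartan subalgebra is its own normalizer. *)
Lemma zero_root_space x : root_space gD i 0 x -> exists t, x = i t.
Proof.
move=> [gDx x0]; case: g_graded => _ [_ _ _ [_ [_ _ _ sn]] _] _.
have [t _ <-] : range i x; last by exists t.
apply: sn => // _ [t _ <-]; rewrite lieC x0 zero_lfunE scale0r oppr0.
by exists 0; rewrite ?linear0.
Qed.

Lemma cartan_weight0 t : gpart 0 (i t).
Proof. by split=> // t'; rewrite cartan_abelian zero_lfunE scale0r. Qed.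

Lemma root_space_graded alpha x : root_space gD i alpha x -> gpart alpha x.
Proof. by case. Qed.

Lemma root_in_weights alpha x : alpha != 0 -> root_space gD i alpha x ->
  x != 0 -> Delta_roots alpha.
Proof. by move=> a0 ax x0; split; [exists x | move=> /eqP; rewrite (negPf a0)]. Qed.

Lemma root_graded_weight alpha : Delta_roots alpha -> graded_weights i alpha.
Proof. by case=> -[x [[_ ax] x0]] a0; split=> //; exists x. Qed.

Lemma roots_finite : finite_set (Delta_roots).
Proof.
by apply: sub_finite_set graded_finite => alpha /root_graded_weight[].
Qed.

(** An element of the Cartan subalgebra killed by all roots is central. *)
Lemma roots_separate t : (forall alpha, Delta_roots alpha -> alpha t = 0) -> t = 0.
Proof.
move=> t0; apply: cartan_inj; rewrite linear0.
apply: gD_center (cartan_gD t) _ => y /gD_gen.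
pose C := [set y | lie (i t) y = 0].
apply: (@lspan_min _ _ _ C) => [|x [alpha _ ax]].
  split=> [|a u v Cu Cv]; first exact: lie0r.
  by rewrite /C /= lie_linearr Cu Cv scaler0 addr0.
rewrite /C /=; have [_ ->] := ax.
have [->|x0] := eqVneq x 0; first by rewrite scaler0.
have [->|a0] := eqVneq alpha 0; first by rewrite zero_lfunE scale0r.
by rewrite t0 ?scale0r //; apply: root_in_weights a0 ax x0.
Qed.

Lemma root_space_lie alpha x y : root_space gD i alpha x ->
  root_space gD i (- alpha) y -> exists s, lie x y = i s.
Proof.
move=> ax ay; apply: zero_root_space; split.
  by apply: gD_lie; [case: ax | case: ay].
move=> t; have [_ ->] := weight_act modg (root_space_graded ax) (root_space_graded ay).
by rewrite subrr.
Qed.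

Lemma coroot_root_neq0 alpha t : is_coroot gD i alpha t -> alpha != 0.
Proof.
move=> [_ at2]; apply: contra_eq_neq at2 => ->.
by rewrite zero_lfunE eq_sym pnatr_eq0.
Qed.

(** The elements s with i s in [g_alpha, g_(- alpha)] are all proportional to
    each other: by the string argument, beta(s) / alpha(s) depends only on the
    root beta, and the roots separate the points of the Cartan subalgebra. *)
Lemma coroot_sl2 alpha t : is_coroot gD i alpha t -> exists x y,
  [/\ root_space gD i alpha x, root_space gD i (- alpha) y & lie x y = i t].
Proof.
move=> ct; have alpha0 := coroot_root_neq0 ct; case: ct => -[n [c [z [zP tE]]]] at2.
have two0 : (2 : R[i]) != 0 by rewrite pnatr_eq0.
have /choice[p pP] : forall j, exists p : g * g * h,
    [/\ root_space gD i alpha p.1.1, root_space gD i (- alpha) p.1.2,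
        z j = lie p.1.1 p.1.2 & lie p.1.1 p.1.2 = i p.2].
  move=> j; have [x [y [ax [ay zj]]]] := zP j.
  by have [s xy] := root_space_lie ax ay; exists (x, y, s).
have tsum : t = \sum_j c j *: (p j).2.
  apply: cartan_inj; rewrite tE linear_sum; apply: eq_bigr => j _.
  by rewrite linearZ; have [_ _ -> ->] := pP j.
have [j aj0] : exists j, alpha (p j).2 != 0.
  apply: contrapT => /forallNP aj; move: at2; rewrite tsum linear_sum big1 /=.
    by move=> /eqP; rewrite eq_sym (negPf two0).
  by move=> j _; rewrite functionalZ; have /negP/negPn/eqP -> := aj j; rewrite mulr0.
have prop : (p j).2 = (alpha (p j).2 / 2) *: t.
  apply/eqP; rewrite -subr_eq0; apply/eqP/roots_separate => beta rb.
  have [a [b ends]] : exists a b, string_ends i (@lie _ g) setT alpha beta a b.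
    apply: string_ends_exist graded_finite alpha0 _.
    by rewrite /on_string string_pt0; case: (root_graded_weight rb).
  have eig k : 2 * beta (p k).2 = (b%:R - a%:R) * alpha (p k).2.
    have [/root_space_graded ax /root_space_graded ay _ xy] := pP k.
    exact (string_eigenvalue modg ends ax ay xy).
  have bt : 2 * beta t = (b%:R - a%:R) * alpha t.
    rewrite tsum !linear_sum !mulr_sumr; apply: eq_bigr => k _.
    by rewrite /= !functionalZ mulrCA eig mulrCA.
  apply: (mulfI two0); rewrite linearB /= functionalZ mulr0 mulrBr eig.
  have -> : 2 * (alpha (p j).2 / 2 * beta t) = alpha (p j).2 / 2 * (2 * beta t).
    by ring.
  by rewrite bt at2 mulrCA mulfVK // mulrC subrr.
have [ax ay _ xy] := pP j.
exists ((alpha (p j).2 / 2)^-1 *: (p j).1.1), (p j).1.2; split=> //.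
  exact: (subspaceZ (wvectors_subspace ad_linear alpha gD_subspace) _ ax).
rewrite (module_actZl modg) // xy {2}prop linearZ scalerA mulVf ?scale1r //.
by rewrite mulf_neq0 // invr_eq0.
Qed.

Lemma graded_nilpotent alpha delta x w : alpha != 0 -> gpart alpha x ->
  gpart delta w -> exists n, iter n (lie x) w = 0.
Proof. exact: weight_nilpotent modg _ _ _ _ graded_finite. Qed.

(** The adjoint module has finitely many weights, so root vectors act locally
    nilpotently on it and sl2-theory applies to all of g, even though g may be
    infinite-dimensional. *)
Lemma coroot_integral alpha beta t : is_coroot gD i alpha t ->
  weights i (@lie _ g) setT beta -> exists k : int, beta t = k%:~R.
Proof.
move=> ct [v [bv v0]]; have alpha0 := coroot_root_neq0 ct.
have [x [y [/root_space_graded ax /root_space_graded ay xy]]] := coroot_sl2 ct.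
have at2 := proj2 ct.
have [|k -> _] := weight_reflection modg ax ay xy at2 _ bv v0; last by exists k.
move=> delta w dw; split; first exact: graded_nilpotent alpha0 ax dw.
by apply: graded_nilpotent ay dw; rewrite oppr_eq0.
Qed.

Lemma h_real_real beta t : h_real gD i t -> weights i (@lie _ g) setT beta ->
  exists r : R, beta t = r%:C.
Proof.
move=> [n [a [c [cP ->]]]] wb.
have /choice[k kP] : forall j, exists k : int, beta (c j) = k%:~R.
  by move=> j; have [alpha _ ca] := cP j; apply: coroot_integral ca wb.
exists (\sum_j a j * (k j)%:~R); rewrite linear_sum rmorph_sum.
by apply: eq_bigr => j _; rewrite /= functionalZ kP rmorphM rmorph_int.
Qed.

Lemma root_reflection alpha : Delta_roots alpha -> exists t,
  is_coroot gD i alpha t /\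
  forall beta, Delta_roots beta -> Delta_roots (beta - beta t *: alpha).
Proof.
case: g_graded => -[_ _ refl _] [_ _ _ _ [phi [phi_lin _ -> cor]]] _.
move=> [d dD <-]; have [f [cf _]] := refl d dD.
have [t [ct tf]] := cor d f dD cf; exists t; split=> // _ [e eD <-].
rewrite tf; exists (e - f e *: d); first by have [_] := cf; apply.
by rewrite addrC -scaleNr phi_lin rmorphN /= scaleNr addrC.
Qed.

End GradedStructure.

(** * The h-finite part of the coinduced module *)

Section CoinducedModule.
Variables (R : realType) (g : banachLieType R[i]) (gD : set g).
Variables (h : vectType R[i]) (i : {linear h -> g}).
Variables (VD : vectType R) (Delta : seq VD).
Hypothesis g_graded : weakly_graded gD i Delta.
Variables (xS : h) (U : algType R[i]) (iota : {linear g -> U}).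
Hypothesis U_env : universal_enveloping iota.
Variables (E : lmodType R[i]) (rho : g -> E -> E).
Hypothesis E_module : lie_module rho (parabolic i xS) setT.
Hypothesis E_weights : finite_sum_of_weight_spaces i rho setT.
Local Notation dual := 'Hom(h, R[i]^o).
Local Notation gpart := (graded_part i).
Local Notation act := (@coind_act R[i] g U iota E).
Local Notation N := (coinduced iota (parabolic i xS) rho).
Local Notation V := (finite_vectors act (range i) N).
Local Notation T := (fun t : h => act (i t)).
Local Notation lm := (lmul iota).
Implicit Types (alpha beta mu nu gamma : dual) (x y : g) (t : h) (b : U -> E).

Let modU := lie_module_lmul U_env.

Lemma coind_act_linear x : linear (act x).
Proof.
move=> a b c; apply/funext => D; rewrite /coind_act.
by rewrite -[RHS]/(a *: - b (iota x * D) + - c (iota x * D)) scalerN -opprD.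
Qed.

Let T_lin t : linear (T t). Proof. exact: coind_act_linear. Qed.

Lemma rho_linear x : parabolic i xS x -> linear (rho x).
Proof. by move=> px a v w; case: E_module => _ _ m _ _; apply: m. Qed.

Lemma rho0 x : parabolic i xS x -> rho x 0 = 0.
Proof.
move=> px; have := rho_linear px (-1) 0 0.
by rewrite !scaleN1r oppr0 addr0 addNr.
Qed.

Lemma coinduced_subspace : subspace N.
Proof.
split=> [|a b c [lb pb] [lc pc]].
  split=> [a u v|x D px] /=; first by rewrite scaler0 addr0.
  by rewrite -[LHS]/(0 : E) -[(_ : U -> E) D]/(0 : E) rho0 ?oppr0.
split=> [d u v|x D px].
  rewrite -[LHS]/(a *: b (d *: u + v) + c (d *: u + v)) lb lc.
  rewrite -[RHS]/(d *: (a *: b u + c u) + (a *: b v + c v)).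
  by rewrite !scalerDr !scalerA [d * a]mulrC addrACA.
rewrite -[LHS]/(a *: b (D * iota x) + c (D * iota x)) pb // pc //.
by rewrite rho_linear // opprD scalerN.
Qed.

Lemma coind_module : lie_module act setT N.
Proof.
have sN := coinduced_subspace.
split=> // [x b _ [lb pb]|x a b c _ _ _|a x y b _ _ [lb _]|x y b _ _ [lb _]].
- split=> [a u v|y D py].
    by rewrite /coind_act mulrDr -scalerAr lb scalerN opprD.
  rewrite /coind_act mulrA pb // opprK.
  have := rho_linear py (-1) (b (iota x * D)) 0.
  by rewrite rho0 // !addr0 !scaleN1r => ->; rewrite opprK.
- exact: coind_act_linear.
- apply/funext => D; rewrite /coind_act.
  rewrite -[RHS]/(a *: - b (iota x * D) + - b (iota y * D)).
  by rewrite linearP mulrDl -scalerAl lb scalerN opprD.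
apply/funext => D; rewrite /coind_act.
rewrite -[RHS]/(- - b (iota y * (iota x * D)) - - - b (iota x * (iota y * D))).
rewrite (proj1 U_env) mulrBl !opprK -!mulrA.
have bN u : b (- u) = - b u.
  have b0 : b 0 = 0.
    by have := lb (-1) 0 0; rewrite !scaleN1r oppr0 addr0 addNr.
  by have := lb (-1) u 0; rewrite addr0 b0 addr0 !scaleN1r.
by have := lb 1 (iota x * (iota y * D)) (- (iota y * (iota x * D)));
  rewrite !scale1r bN => ->; rewrite opprB addrC.
Qed.

Lemma par_l_par x : par_l i xS x -> parabolic i xS x.
Proof.
move=> lx; exists 0, x; rewrite add0r; split=> //.
exact: subspace0 (lspan_subspace _).
Qed.

Lemma par_u_par x : par_u i xS x -> parabolic i xS x.
Proof.
move=> ux; exists x, 0; rewrite addr0; split=> //; split=> //.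
exists 0, 0; rewrite addr0; split; last first.
  by split=> //; apply: subspace0 (lspan_subspace _).
by split=> // t; rewrite lie0r scaler0.
Qed.

Lemma cartan_par t : parabolic i xS (i t).
Proof.
apply: par_l_par; exists (i t), 0; rewrite addr0; split.
  exact: cartan_weight0 g_graded _.
by split=> //; apply: subspace0 (lspan_subspace _).
Qed.

(** D has weight mu for the commutator action of the Cartan subalgebra. *)
Definition adU_weight mu (D : U) : Prop :=
  forall t, iota (i t) * D - D * iota (i t) = mu t *: D.

(** Commutation with h is a derivation, so weights add up along a product. *)
Lemma word_adU_weight (A : set dual) (s : seq g) :
  (forall x, x \in s -> exists2 alpha, A alpha & gpart alpha x) ->
  exists ss : seq dual, [/\ size ss = size s, forall alpha, alpha \in ss -> A alpha
    & adU_weight (\sum_(alpha <- ss) alpha) (foldr lm 1 s)].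
Proof.
elim: s => [|x s IH] sA /=.
  exists [::]; split=> // t; rewrite big_nil zero_lfunE scale0r.
  by rewrite mulr1 mul1r subrr.
have [alpha Aa [_ ax]] := sA x (mem_head _ _).
have [y ys|ss [szs ssA wD]] := IH; first by apply: sA; rewrite inE ys orbT.
exists (alpha :: ss); split=> /= [||t]; first by rewrite szs.
  by move=> beta; rewrite inE => /orP[/eqP->|/ssA].
rewrite big_cons add_lfunE scalerDl /lmul; set D := foldr _ _ _ in wD *.
have <- : iota (lie (i t) x) * D = alpha t *: (iota x * D).
  by rewrite ax linearZ /= scalerAl.
rewrite scalerAr -wD (proj1 U_env) mulrBl mulrBr !mulrA addrA subrK.
by [].
Qed.

Lemma adU_weight_gen (D : U) : lspan [set D | exists mu, adU_weight mu D] D.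
Proof.
have : env_orbit lm (lspan (\bigcup_alpha gpart alpha)) 1 D.
  have := enveloping_generated U_env D.
  by apply: env_orbit_mono => x _; apply: (graded_gen g_graded).
move=> /(env_orbit_lspan modU (v := 1) I).
apply: lspan_mono => _ [s [sG ->]].
have [|ss [_ _ wD]] := @word_adU_weight setT s.
  by move=> x /sG[alpha _ ax]; exists alpha.
by exists (\sum_(alpha <- ss) alpha).
Qed.

(** Weight vectors span U(g). *)
Lemma coinduced_ext b c : N b -> N c ->
  (forall mu D, adU_weight mu D -> b D = c D) -> b = c.
Proof.
move=> [lb _] [lc _] bc; apply/funext => D.
apply: (@lspan_min _ _ _ [set D | b D = c D] _ _ D (adU_weight_gen D)).
  have l0 (f : U -> E) : linear f -> f 0 = 0.
    by move=> lf; have := lf (-1) 0 0; rewrite !scaleN1r oppr0 addr0 addNr.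
  by split=> [|a u v /= bu bv]; [rewrite /= !l0 | rewrite /= lb lc bu bv].
by move=> D' [mu wD]; apply: bc wD.
Qed.

(** Moving i t to the right end of D, where it acts through E, costs the
    commutator, which is mu t times D. *)
Lemma coind_act_eval b mu D t : N b -> adU_weight mu D ->
  act (i t) b D = rho (i t) (b D) - mu t *: b D.
Proof.
move=> [lb pb] wD; rewrite /coind_act.
have -> : iota (i t) * D = mu t *: D + D * iota (i t) by rewrite -wD subrK.
by rewrite lb pb ?opprB ?opprD ?opprK 1?addrC //; apply: cartan_par.
Qed.

Let E_lin t : linear (fun v => rho (i t) v).
Proof. exact: rho_linear (cartan_par t). Qed.

Lemma E_decomposition (v : E) : exists (s : seq dual) (x : dual -> E),
  [/\ uniq s, forall nu, wvectors (fun t => rho (i t)) setT nu (x nu) &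
      v = \sum_(nu <- s) x nu].
Proof.
apply: lspan_bigcup_family => [nu|]; first exact: wvectors_subspace.
exact: (direct_sum_gen (proj1 E_weights)).
Qed.

Lemma coind_act_eval_sum b mu D t (s : seq dual) (x : dual -> E) :
  N b -> adU_weight mu D ->
  (forall nu t', rho (i t') (x nu) = nu t' *: x nu) ->
  b D = \sum_(nu <- s) x nu ->
  act (i t) b D = \sum_(nu <- s) (nu t - mu t) *: x nu.
Proof.
move=> Nb wD wx bD; rewrite (coind_act_eval _ Nb wD) bD (op_sum E_lin).
rewrite scaler_sumr -sumrB; apply: eq_bigr => nu _.
by rewrite wx -scalerBl.
Qed.

Lemma finite_vectors_subspace : subspace V.
Proof.
have sN := coinduced_subspace.
split=> [|a b c [Nb fb] [Nc fc]].
  split; first exact: subspace0.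
  apply: fin_dim_sub (fin_dim_set1 0) => w.
  apply: lspan_min; first by split=> // a u v -> ->; rewrite scaler0 addr0.
  move=> _ [s [_ ->]]; elim: s => //= x s ->; exact: module_act0 coind_module _.
split; first by apply: (proj2 sN).
set F := lspan (env_orbit act (range i) b `|` env_orbit act (range i) c).
have sF : subspace F := lspan_subspace _.
apply: (@fin_dim_sub _ _ _ F); last exact: fin_dim_lspan (fin_dim_setU fb fc).
apply: (lspan_min sF) => _ [s [sk ->]].
have word_lin : foldr act (a *: b + c) s = a *: foldr act b s + foldr act c s.
  by elim: {sk} s => //= x s ->; rewrite coind_act_linear.
rewrite word_lin; apply: (proj2 sF); apply: lspan_gen; [left|right].
  by apply: lspan_gen; exists s.
by apply: lspan_gen; exists s.
Qed.

Lemma finite_vectors_act t b : V b -> V (act (i t) b).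
Proof.
move=> [Nb fb]; split; first exact: (module_mem coind_module).
apply: fin_dim_sub fb; apply: lspan_mono => _ [s [sk ->]].
exists (rcons s (i t)); split; last by rewrite foldr_rcons.
by move=> x; rewrite mem_rcons inE => /orP[/eqP->|/sk//]; exists t.
Qed.

Lemma weight_finite gamma b : weight_space i act N gamma b -> V b.
Proof.
move=> [Nb wb]; split=> //.
apply: fin_dim_sub (fin_dim_lspan (fin_dim_set1 b)); apply: lspan_le.
have sb := lspan_subspace [set b].
move=> _ [s [sk ->]]; elim: s sk => [|x s IH] sk /=; first exact: lspan_gen.
have [t _ <-] := sk x (mem_head _ _).
have : lspan [set b] (foldr act b s).
  by apply: IH => y ys; apply: sk; rewrite inE ys orbT.
pose C := [set c | lspan [set b] (act (i t) c)].
apply: (@lspan_min _ _ _ C) => [|_ ->].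
  split=> [|a u v Cu Cv]; rewrite /C /= ?(op0 T_lin) //; first exact: subspace0.
  by rewrite coind_act_linear; apply: (proj2 sb).
by rewrite /C /= wb; exact: (subspaceZ sb _ (lspan_gen _)).
Qed.

(** A linear relation among the powers T^k b gives a polynomial p; evaluating
    at a weight vector of U and taking a component in E shows that each
    eigenvalue involved is a root of p, so the product of the distinct factors
    of p already annihilates b. *)
Lemma finite_vectors_diag t b : V b -> exists2 rs : seq R[i], uniq rs &
  foldl (fun w r => act (i t) w - r *: w) b rs = 0.
Proof.
move=> Vb; have [Nb fb] := Vb; have sN := coinduced_subspace.
have [n dep] := fin_dim_dependent fb.
have [j|c [[j cj0] sum0]] := dep (fun k : 'I_n.+1 => iter k (T t) b).
  apply: lspan_gen; exists (nseq j (i t)); split.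
    by move=> x /nseqP[-> _]; exists t.
  by elim: (nat_of_ord j) => //= m ->.
pose p := \poly_(k < n.+1) c (inord k).
have p0 : p != 0.
  apply: contra_neq cj0 => p0; have := congr1 (fun q : {poly _} => q`_j) p0.
  by rewrite coef_poly ltn_ord inord_val coef0.
have [r pr] := closed_field_poly_normal p.
have rootr z : root p z -> z \in undup r.
  rewrite mem_undup pr rootZ ?lead_coef_eq0 //.
  by rewrite root_prod_XsubC.
exists (undup r); first exact: undup_uniq.
have NI k : N (iter k (T t) b).
  by elim: k => //= k; apply: (module_mem coind_module).
have NF rs w : N w -> N (foldl (fun w r => act (i t) w - r *: w) w rs).
  elim: rs w => //= z rs IH w Nw; apply: IH; apply: subspaceB => //.
    exact: (module_mem coind_module).
  exact: subspaceZ.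
apply: coinduced_ext (NF _ _ Nb) (subspace0 sN) _ => mu D wD.
have [s [x [us xw bD]]] := E_decomposition (b D).
have wx nu t' : rho (i t') (x nu) = nu t' *: x nu by case: (xw nu).
have wZ a nu t' : rho (i t') (a *: x nu) = nu t' *: (a *: x nu).
  by rewrite (opZ E_lin) wx !scalerA mulrC.
have iterE k : iter k (T t) b D = \sum_(nu <- s) (nu t - mu t) ^+ k *: x nu.
  elim: k => [|k IH] /=.
    by rewrite bD; apply: eq_bigr => nu _; rewrite scale1r.
  rewrite (coind_act_eval_sum (s := s)
    (x := fun nu => (nu t - mu t) ^+ k *: x nu) _ (NI k) wD) //.
  by apply: eq_bigr => nu _; rewrite scalerA -exprS.
have kill nu : nu \in s -> p.[nu t - mu t] *: x nu = 0.
  apply: (weight_component_eq0 E_lin us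
    (x := fun nu => p.[nu t - mu t] *: x nu)) => [nu' _ t'|]; first exact: wZ.
  have sumD := congr1 (fun f : U -> E => f D) sum0.
  rewrite fct_sumE -[RHS]/(0 : E) in sumD; rewrite -[RHS]sumD.
  have termE k : (c k *: iter k (T t) b) D =
      \sum_(nu <- s) (c k * (nu t - mu t) ^+ k) *: x nu.
    rewrite -[LHS]/(c k *: iter k (T t) b D) iterE scaler_sumr.
    by apply: eq_bigr => nu' _; rewrite scalerA.
  rewrite [RHS](eq_bigr _ (fun k _ => termE k)) [RHS]exchange_big.
  apply: eq_bigr => nu' _ /=.
  rewrite horner_poly scaler_suml; apply: eq_bigr => k _.
  by rewrite inord_val.
have foldE rs w (y : dual -> E) : N w ->
    (forall nu t', rho (i t') (y nu) = nu t' *: y nu) ->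
    w D = \sum_(nu <- s) y nu ->
    foldl (fun w r => act (i t) w - r *: w) w rs D =
    \sum_(nu <- s) (\prod_(z <- rs) (nu t - mu t - z)) *: y nu.
  elim: rs w y => [|z rs IH] w y Nw wy wDE /=.
    by rewrite wDE; apply: eq_bigr => nu _; rewrite big_nil scale1r.
  rewrite (IH _ (fun nu => (nu t - mu t - z) *: y nu)).
  - by apply: eq_bigr => nu _; rewrite big_cons scalerA mulrC.
  - apply: (subspaceB sN); first exact: (module_mem coind_module).
    exact: subspaceZ.
  - by move=> nu t'; rewrite (opZ E_lin) wy !scalerA mulrC.
  rewrite -[LHS]/(act (i t) w D - z *: w D) (coind_act_eval_sum t Nw wD wy wDE).
  rewrite wDE scaler_sumr -sumrB; apply: eq_bigr => nu _.
  by rewrite -scalerBl.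
rewrite (foldE _ _ x) // big_seq big1 // => nu nus.
have /eqP := kill nu nus; rewrite scaler_eq0 => /orP[pz|/eqP->]; last first.
  by rewrite scaler0.
rewrite (big_rem (nu t - mu t)) ?rootr //= subrr mul0r scale0r.
by [].
Qed.

Lemma finite_vectors_gen : V `<=` lspan (\bigcup_gamma weight_space i act V gamma).
Proof.
apply: (diagonalizable_wvectors (T := T)) => //.
- exact: finite_vectors_subspace.
- by move=> t b; apply: finite_vectors_act.
- move=> b [Nb _] a t t'; rewrite linearP.
  by rewrite (module_actDl coind_module) // (module_actZl coind_module).
- move=> t t' b [Nb _]; apply/eqP; rewrite -subr_eq0 -(module_lie coind_module) //.
  by rewrite (cartan_abelian g_graded) (module_act0l coind_module).
by move=> t b Vb; apply: finite_vectors_diag.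
Qed.

Lemma finite_vectors_module : lie_module act setT V.
Proof.
have sV := finite_vectors_subspace.
have [_ _ m1 m2 m3] := coind_module.
split=> // [x b _ Vb|x a b c _ [Nb _] [Nc _]|a x y b _ _ [Nb _]|x y b _ _ [Nb _]].
- have VN : (\bigcup_gamma weight_space i act V gamma) `<=` N.
    by move=> c [gamma _ [[]]].
  have Gx : lspan (\bigcup_alpha gpart alpha) x by apply: (graded_gen g_graded).
  apply: (lspan_min sV) (lspan_act coind_module VN Gx (finite_vectors_gen Vb)).
  move=> _ [y [c [[alpha _ ay] [gamma _ [[Nc _] wc]] ->]]].
  exact: weight_finite (weight_act coind_module ay (conj Nc wc)).
- exact: m1.
- exact: m2.
- exact: m3.
Qed.

Definition neg_vectors : set g := \bigcup_(alpha in Sigma_neg i xS) gpart alpha.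

(** g = n + p: a nonzero weight of g lies in Sigma^- as soon as its value at xS is not a
    nonnegative number. *)
Lemma neg_par_gen x : lspan (neg_vectors `|` parabolic i xS) x.
Proof.
have : lspan (\bigcup_alpha gpart alpha) x by apply: (graded_gen g_graded).
apply: lspan_le x => x [alpha _ ax].
have [->|x0] := eqVneq x 0; first exact: subspace0 (lspan_subspace _).
have parG y : parabolic i xS y -> lspan (neg_vectors `|` parabolic i xS) y.
  by move=> py; apply: lspan_gen; right.
have [a0|a0] := eqVneq alpha 0.
  apply/parG/par_l_par; exists x, 0; rewrite addr0 -{1}a0; split=> //.
  by split=> //; apply: subspace0 (lspan_subspace _).
have ga : graded_weights i alpha.
  by split; [exists x | move=> /eqP; rewrite (negPf a0)].
have [ge0|nge0] := pselect (0 <= alpha xS); last first.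
  by apply: lspan_gen; left; exists alpha => //; split=> // -[].
apply: parG; move: ge0; rewrite le_eqVlt => /orP[/eqP az|apos].
  apply: par_l_par; exists 0, x; rewrite add0r; split.
    by split=> // t; rewrite lie0r scaler0.
  by split=> //; apply: lspan_gen; exists alpha.
by apply: par_u_par; apply: lspan_gen; exists alpha.
Qed.

(** U(g) = U(n) U(p) by reordering, where n and p stand for their sets of
    generators, and the value at D p for p in U(p) is determined by the value
    at D. *)
Lemma coinduced_neq0 b : N b -> b != 0 -> exists s : seq g,
  (forall x, x \in s -> neg_vectors x) /\ b (foldr lm 1 s) != 0.
Proof.
move=> Nb; apply: contra_neqP => /forallNP bneg; have [lb pb] := Nb.
have {}bneg s : (forall x, x \in s -> neg_vectors x) -> b (foldr lm 1 s) = 0.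
  by move=> sneg; apply/eqP/negPn/negP => nz; apply: (bneg s).
have bpar (D : U) (s : seq g) : (forall x, x \in s -> parabolic i xS x) ->
    b D = 0 -> b (D * foldr lm 1 s) = 0.
  elim: s D => [|x s IH] D sp bD /=; first by rewrite mulr1.
  rewrite /lmul mulrA; apply: IH => [y ys|]; first by apply: sp; rewrite inE ys orbT.
  have px := sp x (mem_head _ _).
  by rewrite pb // bD rho0 // oppr0.
pose G := neg_vectors `|` parabolic i xS.
pose Z := [set D : U | b D = 0].
have sZ : subspace Z.
  split; last by move=> a u v; rewrite /Z /= => bu bv; rewrite lb bu bv scaler0 addr0.
  by have := lb (-1) 0 0; rewrite /Z /= !scaleN1r oppr0 addr0 addNr.
suff short n : short_words lm G 1 n `<=` Z.
  apply/funext => D; have := enveloping_generated U_env D.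
  apply: (lspan_min sZ) => _ [s [_ ->]].
  have [|n [c [w [wG ->]]]] := word_lspan modU (G := G) (s := s) (v := 1) I.
    by move=> x _; apply: neg_par_gen.
  apply: (subspace_sum sZ) => j _; apply: (subspaceZ sZ).
  have [r [_ rG ->]] := wG j; apply: (short (size r).+1).
  exact: short_words_gen.
elim: n => [|n IH]; first by apply: (lspan_min sZ) => w [s []].
apply: (lspan_min sZ) => _ [s [sn sG ->]].
pose s1 := [seq x <- s | predC (fun x => `[< parabolic i xS x >]) x].
pose s2 := [seq x <- s | `[< parabolic i xS x >]].
have ss : perm_eq s (s1 ++ s2).
  by rewrite perm_sym /s1 perm_catC; apply: permEl; apply: perm_filterC.
rewrite -(subrK (foldr lm 1 (s1 ++ s2)) (foldr lm 1 s)).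
apply: (subspaceD sZ).
  apply: IH; have := @word_perm _ _ _ lm setT modU G 1 _ I s (s1 ++ s2) ss sG.
  move=> /(_ (fun x y _ _ => neg_par_gen _)).
  apply: lspan_mono => w [r [rs rG wr]]; exists r; split=> //.
  by apply: leq_trans rs _; rewrite -ltnS.
rewrite foldr_cat lmul_word; apply: bpar => [x|].
  by rewrite mem_filter => /andP[/asboolP].
apply: bneg => x; rewrite mem_filter => /andP[/asboolPn npx /sG[]//].
Qed.

(** A weight vector b of weight gamma maps a product D of negative weight vectors
    with b D != 0 to a weight vector of E, of weight gamma plus that of D. *)
Lemma weight_of_finite_vectors gamma : weights i act V gamma ->
  exists nu (ss : seq dual), [/\ weights i rho setT nu,
    forall alpha, alpha \in ss -> Sigma_neg i xS alpha &
    gamma = nu - \sum_(alpha <- ss) alpha].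
Proof.
move=> [b [[[Nb _] wb] b0]].
have [s [sneg bs0]] := coinduced_neq0 Nb b0.
have [|ss [_ ssneg wD]] := @word_adU_weight (Sigma_neg i xS) s.
  by move=> x /sneg[alpha]; exists alpha.
exists (gamma + \sum_(alpha <- ss) alpha), ss; split=> //; last by rewrite addrK.
exists (b (foldr lm 1 s)); split=> //; split=> // t.
have := coind_act_eval t Nb wD; rewrite wb => /eqP.
rewrite -[(gamma t *: b) _]/(gamma t *: b _) eq_sym subr_eq => /eqP->.
by rewrite add_lfunE scalerDl.
Qed.

End CoinducedModule.

(** * Locally nilpotent vectors and finiteness *)

Section Nilpotency.
Variables (K : fieldType) (g : lieAlgType K) (M : lmodType K).
Variables (act : g -> M -> M) (W : set M).
Hypothesis modW : lie_module act setT W.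

Definition nilpotent_vectors (x : g) : set M :=
  [set v | W v /\ exists n, iter n (act x) v = 0].

Lemma iter_act_stable x v n m : iter n (act x) v = 0 -> (n <= m)%N ->
  iter m (act x) v = 0.
Proof.
by move=> xn /subnK<-; rewrite iterD xn (iter_act0 modW).
Qed.

Lemma nilpotent_vectors_subspace x : subspace (nilpotent_vectors x).
Proof.
have sW := module_subspace modW.
split=> [|a u v [Wu [n un]] [Wv [m vm]]].
  by split; [apply: subspace0 | exists 0%N].
have Wau := subspaceZ sW a Wu.
split; [exact: subspaceD | exists (n + m)%N].
rewrite (iter_actD modW) // (iter_actZ modW) //.
rewrite (iter_act_stable un (leq_addr _ _)) (iter_act_stable vm (leq_addl _ _)).
by rewrite scaler0 addr0.
Qed.

Lemma nilpotent_locally_finite x : W `<=` nilpotent_vectors x ->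
  act_locally_finite act W x.
Proof.
move=> nil w /nil[_ [n xn]]; apply/fin_dimP.
exists [seq iter k (act x) w | k <- iota 0 n] => _ [k _ <-].
have [kn|nk] := ltnP k n.
  by apply: lspan_gen; apply/mapP; exists k; rewrite ?mem_iota.
rewrite (iter_act_stable xn nk); exact: subspace0 (lspan_subspace _).
Qed.

End Nilpotency.

Lemma finite_bounded_sums (Z : zmodType) (S : set Z) n : finite_set S ->
  finite_set [set z | exists ss : seq Z, [/\ (size ss < n)%N,
    forall x, x \in ss -> S x & z = \sum_(x <- ss) x]].
Proof.
move=> fS; elim: n => [|n IH].
  by apply: sub_finite_set (finite_set0 Z) => z [ss []].
apply: (@sub_finite_set _ _ ([set 0] `|` [set x + z | x in S & z in [set z | exists
    ss : seq Z, [/\ (size ss < n)%N, forall x, x \in ss -> S x & z = \sum_(x <- ss) x]]])).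
  move=> z [[|x ss] [szs sS ->]]; first by left; rewrite big_nil.
  right; exists x; first by apply: sS; rewrite mem_head.
  exists (\sum_(y <- ss) y); last by rewrite big_cons.
  by exists ss; split=> // y ys; apply: sS; rewrite inE ys orbT.
by rewrite finite_setU; split; [exact: finite_set1 | exact: finite_image2].
Qed.

Lemma finite_lists (Z : eqType) (A : set Z) n : finite_set A ->
  finite_set [set l : seq Z | size l = n /\ forall z, z \in l -> A z].
Proof.
move=> fA; elim: n => [|n IH].
  by apply: sub_finite_set (finite_set1 [::]) => l [/size0nil ->].
apply: sub_finite_set (finite_image2 (fun z l => z :: l) fA IH).
case=> [|z l] [] // [szl] lA; exists z; first by apply: lA; rewrite mem_head.
by exists l => //; split=> // w wl; apply: lA; rewrite inE wl orbT.
Qed.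

(** * Heights of weights and the g_Delta-finite vectors *)

Section DeltaFiniteVectors.
Variables (R : realType) (g : banachLieType R[i]) (gD : set g).
Variables (h : vectType R[i]) (i : {linear h -> g}).
Variables (VD : vectType R) (Delta : seq VD).
Hypothesis g_graded : weakly_graded gD i Delta.
Variables (xS : h).
Hypothesis xS_real : h_real gD i xS.
Variables (U : algType R[i]) (iota : {linear g -> U}).
Hypothesis U_env : universal_enveloping iota.
Variables (E : lmodType R[i]) (rho : g -> E -> E).
Hypothesis E_module : lie_module rho (parabolic i xS) setT.
Hypothesis E_weights : finite_sum_of_weight_spaces i rho setT.
Local Notation dual := 'Hom(h, R[i]^o).
Local Notation gpart := (graded_part i).
Local Notation act := (@coind_act R[i] g U iota E).
Local Notation N := (coinduced iota (parabolic i xS) rho).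
Local Notation V := (finite_vectors act (range i) N).
Local Notation VgD := (finite_vectors act gD V).
Local Notation Delta_roots := (Defs.roots gD i).
Implicit Types (alpha beta gamma : dual) (x y : g) (t : h) (v : U -> E).

Let modg := lie_module_ad g.
Let modV := finite_vectors_module g_graded U_env E_module E_weights.
Let T_lin t : linear (act (i t)).
Proof. exact: coind_act_linear. Qed.

(** The real part is taken because the weights of E, unlike those of g, may be
    complex at xS. *)
Definition height alpha : R := complex.Re (alpha xS).

Lemma height0 : height 0 = 0.
Proof. by rewrite /height zero_lfunE. Qed.

Lemma heightD alpha beta : height (alpha + beta) = height alpha + height beta.
Proof. by rewrite /height add_lfunE raddfD. Qed.

Lemma heightB alpha beta : height (alpha - beta) = height alpha - height beta.
Proof. by rewrite /height add_lfunE opp_lfunE raddfB. Qed.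

Lemma graded_height alpha : graded_weights i alpha -> alpha xS = (height alpha)%:C.
Proof.
by move=> [wa _]; have [r ar] := h_real_real g_graded xS_real wa; rewrite /height ar.
Qed.

Lemma Sigma_neg_height alpha : graded_weights i alpha ->
  Sigma_neg i xS alpha <-> height alpha < 0.
Proof.
move=> ga; have ax := graded_height ga; split=> [[_ nS]|neg].
  by rewrite ltNge; apply/negP => ge0; apply: nS; split=> //; rewrite ax lecR.
by split=> // -[_]; rewrite ax lecR leNgt neg.
Qed.

Lemma Sigma_pos_height alpha : graded_weights i alpha ->
  Sigma_pos i xS alpha <-> 0 < height alpha.
Proof.
move=> ga; rewrite /Sigma_pos /= (graded_height ga) ltcR.
by split=> [[]|].
Qed.

Lemma finite_gap (S : set dual) (f : dual -> R) : finite_set S ->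
  (forall alpha, S alpha -> 0 < f alpha) ->
  exists2 e, 0 < e & forall alpha, S alpha -> e <= f alpha.
Proof.
move=> /finite_seqP[s ->]; elim: s => [|a s IH] fpos; first by exists 1.
have [b bs|e e0 es] := IH; first by apply: fpos; rewrite /= inE bs orbT.
exists (Num.min e (f a)); first by rewrite lt_min e0 fpos //= mem_head.
move=> b /=; rewrite inE ge_min => /orP[/eqP->|/es->//].
by rewrite lexx orbT.
Qed.

Lemma finite_lower_bound (S : set dual) (f : dual -> R) : finite_set S ->
  exists m, forall alpha, S alpha -> m <= f alpha.
Proof.
move=> /finite_seqP[s ->]; elim: s => [|a s [m ms]]; first by exists 0.
exists (Num.min m (f a)) => b /=; rewrite inE ge_min => /orP[/eqP->|/ms->//].
by rewrite lexx orbT.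
Qed.

(** The heights of the finitely many elements of Sigma^- are at most - e for some
    e > 0, so each one that is subtracted raises the height by at least e. *)
Lemma weight_height : exists m e, 0 < e /\ forall gamma, weights i act V gamma ->
  exists nu (ss : seq dual), [/\ weights i rho setT nu,
    forall alpha, alpha \in ss -> Sigma_neg i xS alpha,
    gamma = nu - \sum_(alpha <- ss) alpha & m + e * (size ss)%:R <= height gamma].
Proof.
have [m mE] := finite_lower_bound height (proj2 E_weights).
have fneg : finite_set (Sigma_neg i xS).
  by apply: sub_finite_set (graded_finite g_graded) => alpha [[]].
have [|e e0 eneg] := @finite_gap _ (fun alpha => - height alpha) fneg.
  by move=> alpha na; rewrite oppr_gt0; apply/Sigma_neg_height => //; case: na.
exists m, e; split=> // gamma /(weight_of_finite_vectors g_graded U_env E_module).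
move=> [nu [ss [wnu ssn ->]]]; exists nu, ss; split=> //.
rewrite heightB; apply: lerD; first exact: mE.
elim: ss ssn => [|alpha ss IH] ssn.
  by rewrite big_nil mulr0 height0 oppr0.
rewrite big_cons heightD opprD -natr1 mulrDr mulr1 addrC lerD ?eneg //.
  by apply: ssn; rewrite mem_head.
by apply: IH => beta bs; apply: ssn; rewrite inE bs orbT.
Qed.

Lemma height_lower_bound : exists m, forall gamma, weights i act V gamma ->
  m <= height gamma.
Proof.
have [m [e [e0 mP]]] := weight_height; exists m => gamma /mP[nu [ss [_ _ _]]].
by apply: le_trans; rewrite lerDl mulr_ge0 // ltW.
Qed.

Lemma bounded_weights_finite C :
  finite_set [set gamma | weights i act V gamma /\ height gamma <= C].
Proof.
have [m [e [e0 mP]]] := weight_height.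
have fneg : finite_set (Sigma_neg i xS).
  by apply: sub_finite_set (graded_finite g_graded) => alpha [[]].
pose n := (Num.truncn ((C - m) / e)).+1.
apply: sub_finite_set (finite_image2 (fun nu z => nu - z) (proj2 E_weights)
  (finite_bounded_sums n fneg)).
move=> gamma [/mP[nu [ss [wnu ssn -> hg]]] hC]; exists nu => //.
exists (\sum_(alpha <- ss) alpha) => //; exists ss; split=> //.
rewrite -(ltr_nat R); apply: le_lt_trans (truncnS_gt _).
by rewrite ler_pdivlMr // mulrC lerBrDl; apply: le_trans hg hC.
Qed.

(** Iterating x on a weight vector does not raise the height, and only finitely
    many weights of V have height below a given bound. *)
Lemma lowering_nilpotent alpha x : alpha != 0 -> gpart alpha x ->
  height alpha <= 0 -> V `<=` nilpotent_vectors act V x.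
Proof.
move=> a0 ax ha v /(finite_vectors_gen g_graded U_env E_module E_weights).
apply: lspan_min (nilpotent_vectors_subspace modV x) _ _ => {}v [gamma _ gv].
have [Vv _] := gv; split=> //.
have [b bP] := string_bounded gamma (bounded_weights_finite (height gamma)) a0.
exists b.+1; apply/eqP/negPn/negP => nz.
suff /bP : [set gamma' | weights i act V gamma' /\ height gamma' <= height gamma]
  (string_pt alpha gamma b.+1) by rewrite /= ltnn.
split; first by exists (iter b.+1 (act x) v); split=> //; apply: (iter_weight modV).
have neg : alpha xS = (height alpha)%:C \/ x = 0.
  have [->|x0] := eqVneq x 0; first by right.
  left; apply: graded_height; split; first by exists x.
  by move=> /eqP; rewrite (negPf a0).
case: neg => [aE|x0]; last first.
  case/negP: nz; rewrite x0 /=; apply/eqP; apply: (module_act0l modV).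
  exact: (iter_act_mem modV).
rewrite /height string_ptE aE raddfD /= gerDl -pmulrn.
have -> : b.+1%:R * (height alpha)%:C = (b.+1%:R * height alpha)%:C.
  by rewrite rmorphM rmorph_nat.
by rewrite /= mulr_ge0_le0.
Qed.

Lemma cartan_locally_finite t : act_locally_finite act V (i t).
Proof.
move=> v [_ fv]; apply: fin_dim_sub fv => _ [k _ <-].
apply: lspan_gen; exists (nseq k (i t)); split.
  by move=> x /nseqP[-> _]; exists t.
by elim: k => //= k ->.
Qed.

(** Otherwise x would be a sum of vectors of weights other than its own. *)
Lemma lspan_weights_mem (P : set dual) alpha x : gpart alpha x -> x != 0 ->
  lspan (\bigcup_(beta in P) gpart beta) x -> P alpha.
Proof.
move=> ax x0 Px; apply: contrapT => nP.
pose F beta := [set y | gpart beta y /\ (P beta \/ y = 0)].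
have sg beta : subspace (gpart beta).
  exact: (wvectors_subspace (@ad_linear _ _ _ i)).
have /lspan_bigcup_family[beta|s [y [us Fy xE]]] : lspan (\bigcup_beta F beta) x.
- by apply: lspan_mono Px => y [beta Pb by_]; exists beta => //; split=> //; left.
- split=> [|a y z [by_ Py] [bz Pz]].
    by split; [exact: subspace0 | right].
  split; first exact: (proj2 (sg beta)).
  case: Py Pz => [Pb _|->]; first by left.
  by case=> [Pb|->]; [left | right; rewrite scaler0 addr0].
have ya : y alpha = 0 by have [_ []] := Fy alpha.
pose s' := [seq beta <- s | beta != alpha].
have xs' : x = \sum_(beta <- s') y beta.
  rewrite xE big_filter [RHS]big_mkcond; apply: eq_bigr => beta _.
  by case: eqP => //= ->.
case/negP: x0; apply/eqP.
pose z beta := if beta == alpha then - x else y beta.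
have za : z alpha = - x by rewrite /z eqxx.
apply: oppr_inj; rewrite oppr0 -za.
apply: (weight_component_eq0 (@ad_linear _ _ _ i) (s := alpha :: s')) (mem_head _ _).
- by rewrite /= filter_uniq // mem_filter eqxx.
- move=> beta _ t; rewrite /z; case: eqP => [->|_].
    by have [_ ->] := subspaceN (sg alpha) ax.
  by have [[_ ->] _] := Fy beta.
rewrite big_cons za xs' [X in _ + X](eq_big_seq y) ?addNr // => beta.
by rewrite mem_filter /z; case: eqP.
Qed.

(** This contains n_Delta + l_Delta, and since heights add up it is visibly
    closed under brackets. *)
Definition low_part : set g := [set x | gD x /\
  lspan (\bigcup_(alpha in [set alpha | height alpha <= 0]) gpart alpha) x].

Lemma low_part_subspace : subspace low_part.
Proof.
have sD := gD_subspace g_graded.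
split=> [|a x y [gx lx] [gy ly]].
  by split; [exact: subspace0 | exact: subspace0 (lspan_subspace _)].
by split; [apply: (proj2 sD) | apply: (proj2 (lspan_subspace _))].
Qed.

Lemma low_part_lie x y : low_part x -> low_part y -> low_part (lie x y).
Proof.
move=> [gx lx] [gy ly]; split; first exact: (gD_lie g_graded).
apply: lspan_mono (lspan_act modg (@subsetT _ _) lx ly) => _ [x' [y'
  [[alpha ha ax] [beta hb by_] ->]]].
exists (alpha + beta); last exact: (weight_act modg).
by rewrite /= heightD -(addr0 0) lerD.
Qed.

Lemma low_part_gen : low_part `<=`
  lspan (\bigcup_alpha wvectors (fun t => lie (i t)) low_part alpha).
Proof.
apply: (wvectors_gen_sub (@ad_linear _ _ _ i) (W' := setT)) => //.
- exact: low_part_subspace.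
- move=> t x lx; apply: low_part_lie => //; split; first exact: (cartan_gD g_graded).
  apply: lspan_gen; exists 0; last exact: (cartan_weight0 g_graded).
  by rewrite /= height0.
exact: (graded_gen g_graded).
Qed.

(** low_part is spanned by finitely many weight vectors; those of weight 0 come
    from h and the others act nilpotently on each vector of V. *)
Lemma low_part_locally_finite v : V v -> fin_dim (env_orbit act low_part v).
Proof.
move=> Vv; have fl : fin_dim low_part.
  by apply: fin_dim_sub (gD_fin_dim g_graded) => x [].
have [s [sw ls]] := weight_spanning (@ad_linear _ _ _ i) low_part_subspace fl low_part_gen.
have sl x : x \in s -> low_part x by move=> /sw[alpha []].
apply: fin_dim_sub (env_orbit_mono ls) _.
apply: (locally_finite_orbit modV) => // [x y xs ys|x xs].
  by apply/ls/low_part_lie; apply: sl.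
have [alpha [[gx lx] ax]] := sw x xs.
have [a0|a0] := eqVneq alpha 0.
  have [|t ->] := @zero_root_space _ _ _ _ _ _ _ g_graded x; last exact: cartan_locally_finite.
  by rewrite -a0.
apply: (nilpotent_locally_finite modV).
have [->|x0] := eqVneq x 0.
  by move=> w Vw; split=> //; exists 1%N; apply: (module_act0l modV).
apply: lowering_nilpotent a0 _ _ => //.
exact: (lspan_weights_mem (P := [set alpha | height alpha <= 0])) lx.
Qed.

Lemma par_n_low x : par_n i xS x ->
  lspan (\bigcup_(alpha in [set alpha | height alpha <= 0]) gpart alpha) x.
Proof.
apply: lspan_mono => y [alpha na ay]; exists alpha => //=.
by apply/ltW/Sigma_neg_height => //; case: na.
Qed.

Lemma par_l_low x : par_l i xS x ->
  lspan (\bigcup_(alpha in [set alpha | height alpha <= 0]) gpart alpha) x.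
Proof.
move=> [y [z [y0 [zs ->]]]]; apply: (subspaceD (lspan_subspace _)).
  by apply: lspan_gen; exists 0 => //=; rewrite height0.
apply: lspan_mono zs => w [alpha [_ a0] aw]; exists alpha => //=.
by rewrite /height a0.
Qed.

Lemma nD_lD_locally_finite :
  locally_finite_module act (sum_set (par_n i xS `&` gD) (par_l i xS `&` gD)) V.
Proof.
have [s1 s2 s3 s4 s5] := modV; split.
  split=> // [x v _|x a v w _|a x y v _ _|x y v _ _].
  - exact: s2.
  - exact: s3.
  - exact: s4.
  - exact: s5.
apply/seteqP; split=> v; first by case.
move=> Vv; split=> //.
apply: fin_dim_sub (env_orbit_mono _) (low_part_locally_finite Vv).
move=> _ [x [y [[nx gx] [[ly gy] ->]]]]; split.
  by apply: (subspaceD (gD_subspace g_graded)).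
by apply: (subspaceD (lspan_subspace _)); [apply: par_n_low | apply: par_l_low].
Qed.

(** These turn out to be the g_Delta-finite vectors of V; in the present form,
    stability under all of g can be checked one root vector at a time. *)
Definition integrable : set (U -> E) := [set v | V v /\
  forall alpha x, alpha != 0 -> root_space gD i alpha x ->
    nilpotent_vectors act V x v].

Lemma integrable_subspace : subspace integrable.
Proof.
have sV := module_subspace modV; split=> [|a u v [Vu nu] [Vv nv]].
  split=> [|alpha x a0 ax]; first exact: subspace0.
  exact: subspace0 (nilpotent_vectors_subspace modV x).
split=> [|alpha x a0 ax]; first exact: (proj2 sV).
apply: (proj2 (nilpotent_vectors_subspace modV x)); first exact: nu a0 ax.
exact: nv a0 ax.
Qed.

Lemma root_vector_ad_nilpotent alpha x y : alpha != 0 ->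
  root_space gD i alpha x -> exists n, iter n (lie x) y = 0.
Proof.
move=> a0 ax; have : lspan (\bigcup_alpha gpart alpha) y.
  exact: (graded_gen g_graded).
suff sub : lspan (\bigcup_alpha gpart alpha) `<=` nilpotent_vectors (@lie _ g) setT x.
  by move=> /sub[].
apply: lspan_min (nilpotent_vectors_subspace modg x) _ => z [beta _ bz].
by split=> //; apply: (graded_nilpotent g_graded a0 (root_space_graded ax) bz).
Qed.

(** Nilpotency of a root vector on v passes to x v since root vectors are
    ad-nilpotent on all of g. *)
Lemma integrable_module : lie_module act setT integrable.
Proof.
have [_ m1 m2 m3 m4] := modV.
split=> [|x v _ [Vv nv]|x a v w _ [Vv _] [Vw _]|a x y v _ _ [Vv _]|x y v _ _ [Vv _]].
- exact: integrable_subspace.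
- split=> [|alpha y a0 ay]; first exact: m1.
  have [_ [m ym]] := nv alpha y a0 ay.
  have [n yn] := root_vector_ad_nilpotent x a0 ay.
  split; first exact: m1.
  by exists (n + m)%N; apply: (nilpotent_act modV yn ym).
- exact: m2.
- exact: m3.
- exact: m4.
Qed.
Let modI := integrable_module.

(** A finite-dimensional submodule has finitely many weights, so root vectors
    act nilpotently on it; conversely nilpotency of all root vectors is
    inherited by the g-module they generate, where sorted products apply. *)
Lemma finite_vectors_integrable : VgD = integrable.
Proof.
apply/seteqP; split=> [v [Vv fv]|v Iv].
  split=> // alpha x a0 ax.
  set F := env_orbit act gD v in fv.
  have FV : F `<=` V := env_orbit_sub modV Vv.
  have sF : subspace F := lspan_subspace _.
  have Fact y w : gD y -> F w -> F (act y w) := @env_orbit_act _ _ _ _ _ modV gD y v w Vv.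
  have : F v by apply: env_orbit_self.
  have Fgen : F `<=` lspan (\bigcup_gamma wvectors (fun t => act (i t)) F gamma).
    apply: (wvectors_gen_sub T_lin (W' := V)) => //.
    - by move=> t w; apply: Fact; apply: (cartan_gD g_graded).
    - exact: module_subspace modV.
    exact: (finite_vectors_gen g_graded U_env E_module E_weights).
  move=> /Fgen; apply: lspan_min (nilpotent_vectors_subspace modV x) _ _.
  move=> w [gamma _ [Fw gw]]; split; first exact: FV.
  have [b bP] := string_bounded gamma (fin_dim_finite_weights T_lin fv) a0.
  exists b.+1; apply/eqP/negPn/negP => nz.
  suff /bP : [set gamma' | exists v', wvectors (fun t => act (i t)) F gamma' v' /\ v' != 0]
    (string_pt alpha gamma b.+1) by rewrite /= ltnn.
  exists (iter b.+1 (act x) w); split=> //; split.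
    by elim: {nz} b.+1 => //= n; apply: Fact; case: ax.
  by have [] := iter_weight modV b.+1 (root_space_graded ax) (conj (FV _ Fw) gw).
have Vv : V v by case: Iv.
split=> //.
have [s [sw gs]] := weight_spanning (@ad_linear _ _ _ i) (gD_subspace g_graded)
  (gD_fin_dim g_graded) (gD_gen g_graded).
have sg x : x \in s -> gD x by move=> /sw[alpha []].
apply: fin_dim_sub (env_orbit_mono gs) _.
apply: (locally_finite_orbit modI) => // [x y xs ys|x xs].
  by apply/gs/(gD_lie g_graded); apply: sg.
have [alpha ax] := sw x xs.
have [a0|a0] := eqVneq alpha 0.
  have [|t ->] := @zero_root_space _ _ _ _ _ _ _ g_graded x; first by rewrite -a0.
  by move=> w Iw; exact: (cartan_locally_finite _ (proj1 Iw)).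
apply: (nilpotent_locally_finite modI) => w Iw; split=> //.
by have [_ nw] := Iw; have [] := nw alpha x a0 ax.
Qed.

(** An element of the Cartan subalgebra is determined by the list of the values
    of the finitely many roots at it. *)
Lemma finite_root_values (A : set R[i]) : finite_set A ->
  finite_set [set t : h | forall alpha, Delta_roots alpha -> A (alpha t)].
Proof.
move=> fA; have /finite_seqP[rs rsE] := roots_finite g_graded.
pose F t := [seq (alpha t : R[i]) | alpha : dual <- rs].
have F_inj : injective F.
  move=> t t' /eq_in_map Ftt'; apply/eqP; rewrite -subr_eq0; apply/eqP.
  apply: (roots_separate g_graded) => alpha ra; rewrite linearB /= Ftt' ?subrr //.
  by move: ra; rewrite rsE.
apply: sub_finite_set (finite_preimage (in2W F_inj) (finite_lists (size rs) fA)).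
move=> t tA; split; first by rewrite size_map.
by move=> _ /mapP[alpha ars ->]; apply: tA; rewrite rsE.
Qed.

Lemma integrable_gen : integrable `<=` lspan (\bigcup_gamma weight_space i act integrable gamma).
Proof.
apply: (wvectors_gen_sub T_lin (W' := V)) => [||v []//||].
- exact: module_subspace modI.
- by move=> t v; apply: (module_mem modI).
- exact: module_subspace modV.
exact: (finite_vectors_gen g_graded U_env E_module E_weights).
Qed.

(** Root vectors act nilpotently on weight vectors of the integrable part, so
    its weights are stable under reflections by sl2-theory. *)
Lemma integrable_reflection gamma alpha t : is_coroot gD i alpha t ->
  weights i act integrable gamma -> weights i act integrable (gamma - gamma t *: alpha).
Proof.
move=> ct [v [gv v0]]; have alpha0 := coroot_root_neq0 ct.
have at2 := proj2 ct.
have [x [y [ax ay xy]]] := coroot_sl2 g_graded ct.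
have [|k -> ] := weight_reflection modI (root_space_graded ax)
    (root_space_graded ay) xy at2 _ gv v0.
  move=> delta w [[_ nw] _]; split; first by have [] := nw alpha x alpha0 ax.
  have na0 : - alpha != 0 by rewrite oppr_eq0.
  by have [] := nw _ y na0 ay.
by move=> [w [sw w0]]; exists w; split=> //; rewrite -scaleNr -mulrNz.
Qed.

(** The elements t where the roots take values among those at xS and where all
    weights of the integrable part have real part at least m form a finite set,
    which contains xS and is stable under the reflections by reflection
    invariance of the weights. Its sum is fixed by all reflections, so it vanishes, and a weight
    bounded below on each element is therefore bounded above on each. *)
Lemma integrable_height_bound : exists C, forall gamma, weights i act integrable gamma ->
  height gamma <= C.
Proof.
have [m mV] := height_lower_bound.
have mI gamma : weights i act integrable gamma -> m <= height gamma.
  by move=> [v [[[Vv _] wv] v0]]; apply: mV; exists v.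
pose A : set R[i] := [set alpha xS | alpha in Delta_roots].
have fA : finite_set A by apply/finite_image/(roots_finite g_graded).
pose X := [set t : h | (forall alpha, Delta_roots alpha -> A (alpha t)) /\
  forall gamma, weights i act integrable gamma -> m <= complex.Re (gamma t)].
have : finite_set X.
  by apply: sub_finite_set (finite_root_values fA) => t [].
move=> /finite_seqP[r0 Xr0]; pose r := undup r0.
have Xr t : X t <-> t \in r by rewrite Xr0 /= mem_undup.
have ur : uniq r by apply: undup_uniq.
have xr : xS \in r.
  by apply/Xr; split=> [alpha ra|gamma /mI//]; exists alpha.
have sum0 : \sum_(t <- r) t = 0.
  apply: (roots_separate g_graded) => alpha ra.
  have [t [ct refl]] := root_reflection g_graded ra; have at2 := proj2 ct.
  pose s (u : h) := u - alpha u *: t.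
  have sK : involutive s.
    move=> u; rewrite /s linearB /= functionalZ at2.
    have -> : alpha u - alpha u * 2 = - alpha u by ring.
    by rewrite scaleNr opprK subrK.
  have sE (beta : dual) u : beta (s u) = (beta - beta t *: alpha) u.
    rewrite add_lfunE opp_lfunE scale_lfunE /s linearB /= functionalZ.
    by congr (_ - _); apply: mulrC.
  have sX u : X u -> X (s u).
    move=> [Au mu]; split=> [beta rb|gamma wg]; rewrite sE.
      by apply: Au; apply: refl.
    by apply: mu; apply: integrable_reflection.
  have rs : perm_eq r (map s r).
    apply: uniq_perm => //; first by rewrite map_inj_uniq //; apply: inv_inj.
    move=> u; apply/idP/mapP => [/Xr/sX/Xr sur|[w /Xr/sX/Xr wr ->]//].
    by exists (s u) => //; rewrite sK.
  have s_lin : {morph s : u w / u + w}.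
    by move=> u w; rewrite /s linearD /= scalerDl opprD addrACA.
  have s0 : s 0 = 0 by rewrite /s linear0 scale0r subr0.
  have : s (\sum_(u <- r) u) = \sum_(u <- r) u.
    by rewrite (big_morph s s_lin s0) [RHS](perm_big _ rs) big_map.
  move=> /eqP; rewrite /s -subr_eq0 addrAC subrr add0r oppr_eq0 => /eqP tz.
  have /eqP := congr1 alpha tz; rewrite functionalZ linear0 at2 mulf_eq0.
  by rewrite pnatr_eq0 orbF => /eqP.
(* Every element of r other than xS contributes at least m to the sum. *)
exists (- (m *+ size (rem xS r))) => gamma wg.
have Regamma u : u \in r -> m <= complex.Re (gamma u) by move=> /Xr[_]; apply.
have := congr1 (fun u => complex.Re (gamma u)) sum0.
rewrite /= linear0 linear_sum raddf_sum (big_rem xS) //= -/(height gamma).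
move=> /eqP; rewrite addr_eq0 => /eqP->; rewrite lerN2.
have : {in rem xS r, forall u, m <= complex.Re (gamma u)}.
  by move=> u /mem_rem; apply: Regamma.
elim: (rem xS r) => [|u l IH] lm; first by rewrite big_nil.
rewrite big_cons mulrS lerD ?lm ?mem_head // IH // => w wl.
by apply: lm; rewrite inE wl orbT.
Qed.

(** Each factor moves the weight by at least e in the direction of f, while the
    weights of the integrable part have f-values in an interval. *)
Lemma bounded_word_kills (f : dual -> R) (S : set dual) (m M : R) :
  {morph f : alpha beta / alpha + beta} -> finite_set S ->
  (forall alpha, S alpha -> 0 < f alpha) ->
  (forall gamma, weights i act integrable gamma -> m <= f gamma <= M) ->
  exists2 k, (0 < k)%N & forall v, integrable v -> pow_kills act (sum_of_parts i S) k v.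
Proof.
move=> fD fS fpos bnd; have [e e0 eS] := finite_gap fS fpos.
pose k := (Num.truncn ((M - m) / e)).+1; exists k => // v Iv s sk sS.
suff kill (r : seq g) : size r = k ->
    (forall x, x \in r -> (\bigcup_(alpha in S) gpart alpha) x) ->
    foldr act v r = 0.
  have [n [c [w [wP ->]]]] := word_lspan modI Iv sS.
  rewrite big1 // => j _; have [r [szr rS ->]] := wP j.
  by rewrite kill ?scaler0 // szr.
move=> {sk sS}rk rS; have {}rS : forall x, x \in r ->
    exists2 alpha, S alpha & gpart alpha x by [].
have step (u : seq g) gamma w : weight_space i act integrable gamma w ->
    (forall x, x \in u -> exists2 alpha, S alpha & gpart alpha x) ->
    exists2 delta, weight_space i act integrable delta (foldr act w u) &
      f gamma + e * (size u)%:R <= f delta.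
  move=> gw; elim: u => [|x u IH] uS; first by exists gamma; rewrite ?mulr0 ?addr0.
  have [alpha Sa ax] := uS x (mem_head _ _).
  have [y yu|delta dw le_d] := IH; first by apply: uS; rewrite inE yu orbT.
  exists (alpha + delta); first exact: (weight_act modI).
  by rewrite /= fD -natr1 mulrDr mulr1 addrA [f alpha + _]addrC lerD ?eS.
have word0 (u : seq g) : foldr act 0 u = 0.
  by elim: u => //= x u ->; apply: (module_act0 modI).
have := integrable_gen Iv.
pose Z := [set w | integrable w /\ foldr act w r = 0].
suff sub : lspan (\bigcup_gamma weight_space i act integrable gamma) `<=` Z by move=> /sub[].
apply: lspan_min => [|w [gamma _ gw]].
  have sI := module_subspace modI.
  split=> [|a u w [Iu u0] [Iw w0]].
    by split; [exact: subspace0 | apply: word0].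
  split; first exact: (proj2 sI).
  suff -> : foldr act (a *: u + w) r = a *: foldr act u r + foldr act w r.
    by rewrite u0 w0 scaler0 addr0.
  by elim: (r) => //= x l ->; rewrite coind_act_linear.
split; first by case: gw.
have [delta dw le_d] := step r gamma w gw rS.
apply/eqP/negPn/negP => nz.
have w0 : w != 0.
  by apply: contraNneq nz => ->; rewrite word0.
have /andP[mg _] : m <= f gamma <= M by apply: bnd; exists w.
have /andP[_ dM] : m <= f delta <= M by apply: bnd; exists (foldr act w r).
have := truncnS_gt ((M - m) / e); rewrite -/k ltr_pdivrMr // ltNge => /negP; apply.
rewrite mulrC -rk -(lerD2l (f gamma)) (le_trans le_d) //.
by rewrite (le_trans dM) // addrC -lerBlDr lerB.
Qed.

End DeltaFiniteVectors.

(** * The theorem *)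

Theorem theorem2p10 (R : realType) (g : banachLieType R[i]) (gD : set g)
    (h : vectType R[i]) (i : {linear h -> g})
    (VD : vectType R) (Delta : seq VD)
    (g_graded : weakly_graded gD i Delta)
    (xS : h) (xS_real : h_real gD i xS)
    (U : algType R[i]) (iota : {linear g -> U})
    (U_env : universal_enveloping iota)
    (E : lmodType R[i]) (rho : g -> E -> E)
    (E_module : lie_module rho (parabolic i xS) setT)
    (E_weights : finite_sum_of_weight_spaces i rho setT) :
  let act := @coind_act R[i] g U iota E in
  let n := par_n i xS in
  let nD := par_n i xS `&` gD in
  let lD := par_l i xS `&` gD in
  let uD := par_u i xS `&` gD in
  let V := finite_vectors act (range i)
             (coinduced iota (parabolic i xS) rho) in
  let VgD := finite_vectors act gD V in
  [/\ (* (a) *)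
      sum_of_weight_spaces i act V /\
      weights i act V `<=`
        diff_set (weights i rho setT) (nat_span (Sigma_neg i xS)),
      (* (b) *)
      lie_module act setT VgD /\ finite_sum_of_weight_spaces i act VgD,
      (* (c) *)
      locally_finite_module act (sum_set nD lD) V,
      (* (d) *)
      exists k : nat, (0 < k)%N /\ VgD = [set v | V v /\ pow_kills act uD k v] &
      (* (e) *)
      exists k : nat, (0 < k)%N /\ VgD `<=` [set v | V v /\ pow_kills act n k v]].
Proof.
move=> act n nD lD uD V VgD.
have modV := finite_vectors_module g_graded U_env E_module E_weights.
have modI := integrable_module g_graded U_env E_module E_weights.
have VI : VgD = integrable gD i xS iota rho.
  exact (finite_vectors_integrable g_graded U_env E_module E_weights).
have T_lin t : linear (act (i t)) by apply: coind_act_linear.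
have [C leC] := integrable_height_bound g_graded xS_real U_env E_module E_weights.
have [m lem] := height_lower_bound g_graded xS_real U_env E_module E_weights.
have wIV gamma : weights i act (integrable gD i xS iota rho) gamma ->
    weights i act V gamma.
  by move=> [v [[[Vv _] wv] v0]]; exists v.
split.
- split.
    apply: (wvectors_direct_sum T_lin (module_subspace modV)).
    exact (finite_vectors_gen g_graded U_env E_module E_weights).
  move=> gamma /(weight_of_finite_vectors g_graded U_env E_module).
  move=> [nu [ss [wnu ssn ->]]].
  by exists nu, (\sum_(alpha <- ss) alpha); split=> //; split=> //; exists ss.
- rewrite VI; split=> //; split.
    apply: (wvectors_direct_sum T_lin (module_subspace modI)).
    exact (integrable_gen g_graded U_env E_module E_weights).
  apply: sub_finite_set
    (bounded_weights_finite g_graded xS_real U_env E_module E_weights C).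
  by move=> gamma wg; split; [apply: wIV | apply: leC].
- exact: (nD_lD_locally_finite g_graded xS_real U_env E_module E_weights).
- have fpos : finite_set (Sigma_pos i xS).
    by apply: sub_finite_set (graded_finite g_graded) => alpha [[]].
  have [alpha|gamma wg|k k0 kill] := bounded_word_kills g_graded U_env E_module
      E_weights (heightD xS) fpos (m := m) (M := C).
  + by move=> pa; apply/(Sigma_pos_height g_graded xS_real) => //; case: pa.
  + by rewrite lem ?leC //; apply: wIV.
  exists k; split=> //; rewrite VI; apply/seteqP; split=> v.
    move=> Iv; split; first by case: Iv.
    by move=> s sk su; apply: (kill v Iv s sk) => x /su[].
  move=> [Vv killv]; split=> // alpha x a0 ax.
  have [->|x0] := eqVneq x 0.
    by split=> //; exists 1%N; apply: (module_act0l modV).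
  have ga : graded_weights i alpha.
    split; first by exists x; split=> //; apply: root_space_graded ax.
    by move=> /eqP; rewrite (negPf a0).
  have [le0|gt0] := lerP (height xS alpha) 0.
    by apply: (lowering_nilpotent g_graded xS_real U_env E_module E_weights a0
      (root_space_graded ax)).
  split=> //; exists k.
  have -> : iter k (act x) v = foldr act v (nseq k x).
    by elim: k {k0 kill killv} => //= k ->.
  apply: killv => [|y /nseqP[-> _]]; first by rewrite size_nseq.
  split; last by case: ax.
  apply: lspan_gen; exists alpha; last exact: root_space_graded ax.
  exact/(Sigma_pos_height g_graded xS_real).
have fneg : finite_set (Sigma_neg i xS).
  by apply: sub_finite_set (graded_finite g_graded) => alpha [[]].
have [||gamma wg|k k0 kill] := bounded_word_kills g_graded U_env E_module
    E_weights (f := fun alpha => - height xS alpha) _ fneg (m := - C) (M := - m).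
- by move=> alpha beta; rewrite heightD opprD.
- move=> alpha na; rewrite oppr_gt0.
  by apply/(Sigma_neg_height g_graded xS_real) => //; case: na.
- by rewrite !lerN2 lem ?leC //; apply: wIV.
exists k; split=> //; rewrite VI => v Iv.
by split; [case: Iv | apply: kill].
Qed.
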